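(* Let $A$ be a tree with vertex set $V(A)$, let $f\colon V(A)\to I$ be a coloring function, and assume that $\mathrm{Aut}_f^+(A)$ is boundedly simple and nontrivial. Then $\mathrm{Aut}_f^+(A)$ fixes some vertex of $A$, or leaves invariant some end of $A$, or leaves invariant a subtree $A'\subseteq A$ which is a uniform subdivision of an $(n,m)$-regular tree, for some cardinals $n,m\geq 3$. In particular, if $\mathrm{Aut}_f^+(A)$ leaves no nonempty proper subtree of $A$ invariant and stabilizes no end of $A$, then $A$ is a uniform subdivision of a biregular tree and $\mathrm{Aut}_f^+(A)$ is $8$-boundedly simple.
   Context: A tree is a connected graph without cycles. $\mathrm{Aut}(A)$ is the group of permutations of $V(A)$ preserving edges. For a coloring $f\colon V(A)\to I$, $\mathrm{Aut}_f(A)=\{\alpha\in\mathrm{Aut}(A): f\circ\alpha=f\}$, and $\mathrm{Aut}_f^+(A)$ is the subgroup of $\mathrm{Aut}_f(A)$ generated by all pointwise stabilizers in $\mathrm{Aut}_f(A)$ of edges $\{x,y\}$ of $A$. A group $G$ is $N$-boundedly simple if for every two nontrivial $g,h\in G$, $h$ is a product of $N$ or fewer conjugates of $g^{\pm1}$; $G$ is boundedly simple if it is $N$-boundedly simple for some $N\in\mathbb N$. Ends of $A$ are equivalence classes of one-way infinite chains (sequences of distinct, consecutively adjacent vertices), where $C\sim C'$ iff $C\cap C'$ is a one-way infinite chain. A group leaves invariant (stabilizes) an end $b$ if $\alpha(b)=b$ for all its elements $\alpha$. Invariance of a subtree means setwise invariance. The $(n,m)$-regular (biregular) tree, for cardinals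 $n,m\geq3$, is the tree whose vertices are colored black and white, vertices of the same color being non-adjacent, each white vertex having exactly $n$ black neighbors and each black vertex exactly $m$ white neighbors. A uniform subdivision of the $(n,m)$-regular tree is this tree with every edge subdivided, in an equivariant way, into the same number $k\geq 1$ of edges. Equivalently, it is the tree whose vertices can be colored with colors $\{0,\dots,k\}$ so that each vertex of color $0$ has exactly $n$ neighbors of color $1$, each vertex of color $k$ has exactly $m$ neighbors of color $k-1$, each vertex of color $i$ with $0<i<k$ has exactly one neighbor of color $i-1$ and one of color $i+1$, and there are no other adjacencies. *)

(* Defs.v *)
From HB Require Import structures.
From mathcomp Require Import all_boot.
From mathcomp Require Import boolp classical_sets functions cardinality.

Set Implicit Arguments.
Unset Strict Implicit.
Unset Printing Implicit Defensive.

Local Open Scope classical_set_scope.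
Local Open Scope card_scope.

(* Permutations of an arbitrary (possibly infinite) type, as a group under
   composition: [(g * h) x = g (h x)], the opposite of the convention that
   MathComp uses for ['S_n]. *)
Section Permutations.
Variable V : Type.

Record permutation := Permutation {
  perm_fun :> V -> V;
  perm_inv : V -> V;
  perm_funK : cancel perm_fun perm_inv;
  perm_invK : cancel perm_inv perm_fun
}.

Lemma permutation_eq (g h : permutation) : (forall x, g x = h x) -> g = h.
Proof.
case: g h => [g g' gK g'K] [h h' hK h'K] /= /funext egh; subst h.
have egh' : g' = h' by apply/funext => x; rewrite -{1}(h'K x) gK.
subst h'; congr Permutation; exact: Prop_irrelevance.
Qed.

HB.instance Definition _ := gen_eqMixin permutation.
HB.instance Definition _ := gen_choiceMixin permutation.

Definition perm_one := @Permutation id id (fun=> erefl) (fun=> erefl).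

Definition perm_mul (g h : permutation) :=
  Permutation (can_comp (perm_funK g) (perm_funK h))
              (can_comp (perm_invK h) (perm_invK g)).

Definition perm_inverse (g : permutation) :=
  Permutation (perm_invK g) (perm_funK g).

Fact perm_mulA : associative perm_mul.
Proof. by move=> g h k; apply: permutation_eq. Qed.

Fact perm_mul1 : left_id perm_one perm_mul.
Proof. by move=> g; apply: permutation_eq. Qed.

Fact perm_mulr1 : right_id perm_one perm_mul.
Proof. by move=> g; apply: permutation_eq. Qed.

Fact perm_mulV : left_inverse perm_one perm_inverse perm_mul.
Proof. by move=> g; apply: permutation_eq => x /=; rewrite perm_funK. Qed.

Fact perm_mulrV : right_inverse perm_one perm_inverse perm_mul.
Proof. by move=> g; apply: permutation_eq => x /=; rewrite perm_invK. Qed.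

HB.instance Definition _ := isGroup.Build permutation
  perm_mulA perm_mul1 perm_mulr1 perm_mulV perm_mulrV.

End Permutations.

Section BoundedSimplicity.
Variable gT : groupType.
Local Open Scope group_scope.

Definition subgroup_set (H : set gT) : Prop := group_closed (mem H).

Definition generated_subgroup (S : set gT) : set gT := smallest subgroup_set S.

Definition nontrivial_subgroup (G : set gT) : Prop := exists2 g, G g & g <> 1.

(* The conjugating elements range over the subgroup [G], not over [gT]. *)
Definition n_boundedly_simple (N : nat) (G : set gT) : Prop :=
  forall g h : gT, G g -> g <> 1 -> G h -> h <> 1 ->
  exists s : seq gT,
    [/\ (size s <= N)%N,
        forall k, k \in s -> exists2 u, G u & k = g ^ u \/ k = g^-1 ^ u
      & h = \prod_(k <- s) k].

Definition boundedly_simple (G : set gT) : Prop :=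
  exists N, n_boundedly_simple N G.

End BoundedSimplicity.

Section Trees.
Variables (V : Type) (E : rel V).

Definition connected_graph : Prop :=
  forall x y, exists2 p, path E x p & last x p = y.

(* [{classic V}] is [V] with its classical decidable equality, needed by [uniq].
   Cycles of size at most 2 are loops and edges traversed back and forth. *)
Definition acyclic_graph : Prop :=
  forall p : seq {classic V}, uniq p -> cycle E p -> (size p <= 2)%N.

(* The empty graph is not excluded here. *)
Definition is_tree : Prop :=
  [/\ symmetric E, irreflexive E, connected_graph & acyclic_graph].

Definition induced (S : set V) : rel S := fun x y => E (val x) (val y).

Definition automorphisms : set (permutation V) :=
  [set g | forall x y, E (g x) (g y) = E x y].

Definition color_automorphisms (I : Type) (f : V -> I) : set (permutation V) :=
  [set g | automorphisms g /\ f \o g = f].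

Definition edge_stabilizer (I : Type) (f : V -> I) (x y : V) :
    set (permutation V) :=
  [set g | [/\ color_automorphisms f g, g x = x & g y = y]].

Definition color_automorphisms_plus (I : Type) (f : V -> I) :
    set (permutation V) :=
  generated_subgroup
    [set g | exists x y, E x y /\ edge_stabilizer f x y g].

Definition is_ray (r : nat -> V) : Prop :=
  injective r /\ forall i, E (r i) (r i.+1).

Definition ray_equiv (r r' : nat -> V) : Prop :=
  exists2 r'', is_ray r'' & range r'' = range r `&` range r'.

Definition is_end (b : set (nat -> V)) : Prop :=
  exists2 r, is_ray r & b = [set r' | is_ray r' /\ ray_equiv r r'].

Definition fixes_vertex (G : set (permutation V)) (x : V) : Prop :=
  forall g, G g -> g x = x.

Definition fixes_end (G : set (permutation V)) (b : set (nat -> V)) : Prop :=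
  forall g, G g -> [set (g : V -> V) \o r | r in b] = b.

Definition leaves_invariant (G : set (permutation V)) (S : set V) : Prop :=
  forall g, G g -> (g : V -> V) @` S = S.

End Trees.

(* A set of vertices stands for the subgraph it induces: a connected subgraph
   of a tree is always induced. *)
Definition is_subtree (V : Type) (E : rel V) (S : set V) : Prop :=
  is_tree (@induced V E S).

(* The cardinals n and m are those of the types [N] and [M], and every edge of
   the (n,m)-regular tree is subdivided into [k] edges. The color of a vertex is
   its position along a subdivided edge: the white and black vertices of the
   (n,m)-regular tree get the colors 0 and [k]. *)
Definition uniform_subdivision (N M : Type) (k : nat) (V : Type) (E : rel V) :
    Prop :=
  [/\ is_tree E, inhabited V, (0 < k)%N
    & exists c : V -> nat,
      [/\ forall x, (c x <= k)%N,
          forall x y, E x y -> c y = (c x).+1 \/ c x = (c y).+1,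
          forall x, c x = 0 -> [set y | E x y /\ c y = 1] #= [set: N],
          forall x, c x = k -> [set y | E x y /\ c y = k.-1] #= [set: M]
        & forall x, (0 < c x < k)%N ->
            (exists! y, E x y /\ c y = (c x).-1) /\
            (exists! y, E x y /\ c y = (c x).+1)]].

Definition is_uniform_subdivision_of_biregular (V : Type) (E : rel V) : Prop :=
  exists (N M : Type) (k : nat),
    [/\ `I_3 #<= [set: N], `I_3 #<= [set: M] & uniform_subdivision N M k E].

(* Main.v *)
(* A minimal nonempty convex subset S invariant under G = Aut_f^+ exists by Zorn's
   lemma unless G fixes an end: the points of a chain with empty intersection
   nearest to a given vertex run off along a ray, whose end is fixed.

   Bounded simplicity forces the stabilizer of a branching vertex b of S to be
   transitive on the directions at b in S. Otherwise there are directions e1, e2,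
   e3 at b with e1 equivalent neither to e2 nor to e3. Label 1 the directions at
   the translates of b that are equivalent to e1, and 2 the other ones. Since G is
   generated by elements fixing a vertex, a geodesic which leaves a translate of b
   in some direction first meets the orbit again through an equivalent direction.
   Hence every sequence of labels without two consecutive 1 is the itinerary of a
   geodesic, and the periodic itinerary (1 2 1 22 1 222) is that of the axis of some
   t in G. This word is not a cyclic rotation of its reverse, so counting a pattern
   in the itinerary of [x, g x], minus the same count for the reversed itinerary,
   is a quasimorphism on G which is unbounded on the powers of t, whereas it is
   bounded on the products of N conjugates of t and its inverse.

   If S had no branching vertex it would be a line, and G would act on it with two
   reflections a, c without common fixed vertex; every product of conjugates of
   a * c and its inverse preserves the orientation, but a does not. Local
   transitivity then makes S a uniform subdivision.

   When S is the whole tree, gluing automorphisms along edges shows that every h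
   in G is a product of two elements, each of which fixes pointwise a halftree at a
   branching vertex. From g <> 1 one gets a hyperbolic t = g * g ^ u with a halftree Y
   whose translates by the powers of t are disjoint; an element s supported on Y
   is the commutator of the infinite product of the t ^ i * s * t ^ - i with t, so it
   is a product of a conjugate of t and one of its inverse, that is of four
   conjugates of g and its inverse. *)

Require Import Defs.
From mathcomp Require Import all_boot all_algebra.
From mathcomp Require Import boolp classical_sets functions cardinality.
From mathcomp Require Import zify.

Set Implicit Arguments.
Unset Strict Implicit.
Unset Printing Implicit Defensive.

(** * Geodesics in trees *)

(** The vertices form an [eqType] so that [uniq] and list membership apply directly; the theorem
    instantiates it with [{classic V}]. *)
Record tree := Tree {
  vertex :> eqType;
  adjacent : rel vertex;
  adjacent_sym : symmetric adjacent;
  adjacent_irr : irreflexive adjacent;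
  adjacent_connected : connected_graph adjacent;
  adjacent_acyclic :
    forall p : seq vertex, uniq p -> cycle adjacent p -> size p <= 2
}.

Section TreeGeometry.
Variable T : tree.
Local Notation V := (vertex T).
Local Notation E := (@adjacent T).
Let symE := @adjacent_sym T.
Let irrE := @adjacent_irr T.
Let connE := @adjacent_connected T.
Let acyE := @adjacent_acyclic T.

Definition simple_path x p := path E x p && uniq (x :: p).

Fixpoint nonbacktracking u v p :=
  if p is w :: p' then [&& u != w, E v w & nonbacktracking v w p'] else true.

Definition reduced x p :=
  if p is y :: p' then E x y && nonbacktracking x y p' else true.

Lemma reduced_path x p : reduced x p -> path E x p.
Proof.
case: p => //= y p /andP[-> /=]; elim: p x y => //= w p IH x y.
by case/and3P=> _ -> /IH.
Qed.

Lemma nonbacktracking_catl u v p q :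
  nonbacktracking u v (p ++ q) -> nonbacktracking u v p.
Proof. by elim: p u v => //= w p IH u v /and3P[-> -> /IH]. Qed.

Lemma reduced_catl x p q : reduced x (p ++ q) -> reduced x p.
Proof. by case: p => //= y p /andP[-> /nonbacktracking_catl]. Qed.

Lemma nonbacktracking_triple u v p a b q :
  ~~ nonbacktracking u v (p ++ [:: a, b, a & q]).
Proof.
by elim: p u v => /= [|w p IH] u v; rewrite ?eqxx ?andbF //= (negPf (IH _ _)) !andbF.
Qed.

(** Induction on the last vertex. If it occurred earlier, the portion in between would be a simple
    cycle, of length at most 2 by acyclicity: a loop, or an immediate backtrack. *)
Lemma reduced_uniq x p : reduced x p -> uniq (x :: p).
Proof.
elim/last_ind: p => // p z IH redp.
have redp' : reduced x p by apply: (@reduced_catl x p [:: z]); rewrite cats1.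
have := reduced_path redp; rewrite rcons_path => /andP[pathp Ez].
rewrite -rcons_cons rcons_uniq IH // andbT; apply/negP => zxp.
have [s1 [s2 def]] : exists s1 s2, x :: p = s1 ++ z :: s2.
  by move: zxp; move: (x :: p) => l /splitPr[s1 s2]; exists s1, s2.
have := IH redp'; rewrite def cat_uniq => /and3P[_ _ uq] {IH redp' zxp}.
have {pathp Ez} cyc : cycle E (z :: s2).
  rewrite /= rcons_path; case: s1 def => [|a s1] /= [? ?]; subst.
    by rewrite pathp.
  move: pathp Ez; rewrite cat_path /= last_cat /= => /and3P[_ _ ->].
  by move=> ->.
have := acyE uq cyc; case: s2 uq cyc def => [|u [|]] //=; first by rewrite irrE.
move=> _ _ def _; case: s1 def => [|a s1] [? ?]; subst.
  by move: redp; rewrite /= eqxx andbF.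
move: redp; rewrite -cats1 -catA /=.
case: s1 => [|b s1]; first by rewrite /= eqxx !andbF.
by rewrite /= => /andP[_]; rewrite (negPf (nonbacktracking_triple _ _ _ _ _ _)).
Qed.

Lemma simple_reduced x p : simple_path x p -> reduced x p.
Proof.
case/andP; case: p => //= y p /andP[-> /=].
elim: p x y => //= w p IH x y /andP[-> pw] /andP[nx /andP[ny u]].
rewrite IH //=; last by rewrite ny.
by move: nx; rewrite !inE !negb_or => /and3P[_ -> _].
Qed.

Lemma simpleP x p : simple_path x p = reduced x p.
Proof.
apply/idP/idP => [/simple_reduced //|r].
by rewrite /simple_path reduced_path // reduced_uniq.
Qed.

Lemma nonbacktracking_cat u w t v b q :
  nonbacktracking u w (rcons t v) -> E v b -> last w t != b ->
  nonbacktracking v b q -> nonbacktracking u w (rcons t v ++ b :: q).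
Proof.
elim: t u w => [|a t IH] u w /=.
  by move=> /and3P[-> -> _] -> -> ->.
by move=> /and3P[-> -> n] Eb l nq; rewrite IH.
Qed.

Lemma reduced_cat x t v b q :
  reduced x (rcons t v) -> E v b -> last x t != b ->
  nonbacktracking v b q -> reduced x (rcons t v ++ b :: q).
Proof.
case: t => [|a t] /=.
  by move=> /andP[-> _] -> -> ->.
by move=> /andP[-> n] Eb l nq; rewrite nonbacktracking_cat.
Qed.

Lemma simple_rev x p :
  simple_path x p -> simple_path (last x p) (rev (belast x p)).
Proof.
rewrite /simple_path => /andP[pp up]; apply/andP; split.
  by rewrite rev_path; under eq_path => a b do rewrite symE.
by rewrite -rev_rcons -lastI rev_uniq.
Qed.

(** The only possible backtrack of the concatenation is at [x], where [a != b] excludes it; so the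
    path is reduced, hence simple. *)
Lemma simple_fork x a p b q :
  simple_path x (a :: p) -> simple_path x (b :: q) -> a != b ->
  simple_path (last a p) (rev (belast x (a :: p)) ++ b :: q).
Proof.
move=> /simple_rev sp; rewrite !simpleP /= => /andP[Eb nq] ab.
move: sp; rewrite simpleP /= !rev_cons => sp.
apply: reduced_cat => //.
suff -> : last (last a p) (rev (belast a p)) = a by [].
have : rev (a :: p) = last a p :: rev (belast a p) by rewrite lastI rev_rcons.
by move=> /(congr1 (last x)) /= <-; rewrite rev_cons last_rcons.
Qed.

(** If two simple paths with the same endpoints diverged, [simple_fork] would produce a simple path
    returning to its starting point. *)
Lemma simple_unique x p q :
  simple_path x p -> simple_path x q -> last x p = last x q -> p = q.
Proof.
elim: p x q => [|a p IH] x [|b q] //=.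
- by move=> _ /andP[_ /= /andP[nx _]] e; rewrite e mem_last in nx.
- by move=> /andP[_ /= /andP[nx _]] _ e; rewrite -e mem_last in nx.
move=> sp sq e; have [ab|ab] := eqVneq a b; last first.
  have /andP[_ /= /andP[]] := simple_fork sp sq ab.
  by rewrite mem_cat e mem_last orbT.
subst b; congr cons; apply: (IH a) => //.
- by move: sp => /andP[/= /andP[_ pp] /andP[_ up]]; rewrite /simple_path pp.
- by move: sq => /andP[/= /andP[_ pp] /andP[_ up]]; rewrite /simple_path pp.
Qed.

Lemma simple_exists x y : exists p, simple_path x p /\ last x p = y.
Proof.
have [p pp <-] := connE x y; have [p' pp' up' _] := shortenP pp.
by exists p'; rewrite /simple_path pp' up'.
Qed.

Definition geodesic x y : seq V := sval (cid (simple_exists x y)).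

Definition dist x y := size (geodesic x y).

Lemma geodesic_simple x y : simple_path x (geodesic x y).
Proof. by rewrite /geodesic; case: cid => p []. Qed.

Lemma geodesic_last x y : last x (geodesic x y) = y.
Proof. by rewrite /geodesic; case: cid => p []. Qed.

Lemma geodesic_eq x y p : simple_path x p -> last x p = y -> geodesic x y = p.
Proof. by move=> sp l; apply: simple_unique (geodesic_simple _ _) sp _;
  rewrite geodesic_last. Qed.

Lemma geodesicxx x : geodesic x x = [::]. Proof. exact: geodesic_eq. Qed.

Lemma geodesic_rev x y : geodesic y x = rev (belast x (geodesic x y)).
Proof.
apply: geodesic_eq; first by rewrite -{1}[y](geodesic_last x);
  apply: simple_rev (geodesic_simple _ _).
move: (geodesic_last x y); case: (geodesic x y) => //= a p _.
by rewrite rev_cons last_rcons.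
Qed.

Lemma distC x y : dist x y = dist y x.
Proof. by rewrite /dist [geodesic y x]geodesic_rev size_rev size_belast. Qed.

Lemma distxx x : dist x x = 0. Proof. by rewrite /dist geodesicxx. Qed.

Lemma dist_eq0 x y : dist x y = 0 -> x = y.
Proof. by move=> /size0nil e; rewrite -(geodesic_last x y) e. Qed.

Lemma simple_catl x p q : simple_path x (p ++ q) -> simple_path x p.
Proof.
rewrite /simple_path cat_path -cat_cons cat_uniq.
by move=> /andP[/andP[-> _] /and3P[-> _ _]].
Qed.

Lemma simple_catr x p q : simple_path x (p ++ q) -> simple_path (last x p) q.
Proof.
rewrite /simple_path cat_path -cat_cons lastI cat_rcons cat_uniq.
by move=> /andP[/andP[_ ->] /and3P[_ _ ->]].
Qed.

Lemma common_prefix (p q : seq V) : exists c p' q',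
  [/\ p = c ++ p', q = c ++ q' &
      [\/ p' = [::], q' = [::] |
      exists a b s t, [/\ p' = a :: s, q' = b :: t & a != b]]].
Proof.
elim: p q => [|a p IH] [|b q].
- by exists [::], [::], [::]; split=> //; apply: Or31.
- by exists [::], [::], (b :: q); split=> //; apply: Or31.
- by exists [::], (a :: p), [::]; split=> //; apply: Or32.
have [<-|ab] := eqVneq a b; last first.
  by exists [::], (a :: p), (b :: q); split=> //; apply: Or33; exists a, b, p, q.
have [c [p' [q' [-> -> H]]]] := IH q.
by exists (a :: c), p', q'.
Qed.

(** The median is the last vertex of the common prefix of the geodesics from [x] to [y] and to [z].
    What remains of them diverges there, so it joins into the geodesic from [y] to [z]. *)
Lemma geodesic_median x y z : exists m,
  [/\ geodesic x z = geodesic x m ++ geodesic m z, geodesic x y = geodesic x m ++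
    geodesic m y &
      geodesic y z = geodesic y m ++ geodesic m z].
Proof.
have [c [p [q [ep eq H]]]] := common_prefix (geodesic x y) (geodesic x z).
exists (last x c); set m := last x c.
have gxm : geodesic x m = c.
  by apply: geodesic_eq => //; have := geodesic_simple x y; rewrite ep => /simple_catl.
have lp : last m p = y by rewrite -(geodesic_last x y) ep last_cat.
have lq : last m q = z by rewrite -(geodesic_last x z) eq last_cat.
have sp : simple_path m p by have := geodesic_simple x y; rewrite ep => /simple_catr.
have sq : simple_path m q by have := geodesic_simple x z; rewrite eq => /simple_catr.
have gp : geodesic m y = p by apply: geodesic_eq.
have gq : geodesic m z = q by apply: geodesic_eq.
rewrite gxm gp gq; split=> //; case: H => [p0|q0|[a [b [s [t [pe qe ab]]]]]].
- by have -> : y = m; rewrite -?lp ?p0 // geodesicxx /= gq.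
- by have -> : z = m; rewrite -?lq ?q0 // cats0.
rewrite [geodesic y m]geodesic_rev gp pe qe; rewrite pe in sp lp; rewrite qe in sq lq.
apply: geodesic_eq; first by have := simple_fork sp sq ab;
  rewrite -[last a s]/(last m (a :: s)) lp.
by rewrite last_cat /= -[last b t]/(last m (b :: t)).
Qed.

(** * Betweenness and halftrees *)

Definition between x m z := dist x z = dist x m + dist m z.

Lemma median x y z : exists m, [/\ between x m z, between x m y & between y m z].
Proof.
have [m [e1 e2 e3]] := geodesic_median x y z.
by exists m; rewrite /between /dist e1 e2 e3 !size_cat.
Qed.

Lemma dist_triangle x y z : dist x z <= dist x y + dist y z.
Proof.
have [m [-> -> ->]] := median x y z; rewrite (distC y m).
lia.
Qed.

Lemma geodesic_between x m z : between x m z ->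
  geodesic x z = geodesic x m ++ geodesic m z.
Proof.
move=> b; have [n [e1 e2 e3]] := geodesic_median x m z.
suff -> : m = n by [].
apply: dist_eq0; move: b; rewrite /between /dist e1 e2 e3 !size_cat.
by have := distC n m; rewrite /dist; lia.
Qed.

Lemma betweenC x m z : between x m z -> between z m x.
Proof. by rewrite /between (distC x z) (distC x m) (distC m z) addnC. Qed.

Lemma between_unique x m m' z : between x m z -> between x m' z ->
  dist x m = dist x m' -> m = m'.
Proof.
move=> /geodesic_between e1 /geodesic_between; rewrite e1 => /eqP e dm.
rewrite eqseq_cat // in e; move/andP: e => [/eqP e _].
by rewrite -(geodesic_last x m) e geodesic_last.
Qed.

Lemma between_exists x z n : n <= dist x z -> exists2 m, between x m z & dist x m = n.
Proof.
move=> le; pose p := take n (geodesic x z).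
have sp : size p = n by rewrite size_takel.
have e : geodesic x z = p ++ drop n (geodesic x z) by rewrite cat_take_drop.
have := geodesic_simple x z; rewrite e => sz.
have g1 : geodesic x (last x p) = p by apply: geodesic_eq => //; apply: simple_catl sz.
have g2 : geodesic (last x p) z = drop n (geodesic x z).
  apply: geodesic_eq; first exact: simple_catr sz.
  by rewrite -last_cat cat_take_drop geodesic_last.
exists (last x p); last by rewrite /dist g1.
by rewrite /between /dist g1 g2 [in LHS]e size_cat.
Qed.

Lemma geodesicE x y : E x y -> geodesic x y = [:: y].
Proof.
move=> Exy; apply: geodesic_eq => //.
have ne : x != y by apply/eqP => e; rewrite e irrE in Exy.
by rewrite /simple_path /= Exy inE ne.
Qed.

Lemma dist_adjacent x y : E x y ->
  dist x y = 1. Proof. by rewrite /dist => /geodesicE ->. Qed.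

Lemma adjacent_of_dist1 x y : dist x y = 1 -> E x y.
Proof.
rewrite /dist; have := geodesic_last x y; have /andP[+ _] := geodesic_simple x y.
by case: geodesic => [|a [|]] //= /andP[e _] <-.
Qed.

Lemma next_exists x z : x <> z -> exists y, E x y /\ dist x z = (dist y z).+1.
Proof.
move=> ne; have : 1 <= dist x z by rewrite lt0n; apply/eqP => /dist_eq0.
case/between_exists => y b dy; exists y; split; first exact: adjacent_of_dist1.
by rewrite b dy.
Qed.

Lemma adjacent_dist x y z : E x y ->
  dist x z = (dist y z).+1 \/ dist y z = (dist x z).+1.
Proof.
move=> /dist_adjacent Exy; have [m [b1 b2 b3]] := median x y z.
by move: b1 b2 b3; rewrite /between Exy (distC y m); case: (dist x m) => [|[|]]; lia.
Qed.

(* For adjacent [v] and [x], this is the side of [x] in the tree without the edge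
   [v - x]. *)
Definition halftree v x : set V := [set z | dist v z = (dist x z).+1]%classic.

Lemma halftreeC v x z : E v x -> ~ halftree v x z -> halftree x v z.
Proof. by rewrite /halftree /= => /(adjacent_dist z) []. Qed.

Lemma halftree_disj v x z : halftree v x z -> halftree x v z -> False.
Proof. rewrite /halftree /=; lia. Qed.

Lemma next_unique x y y' z : E x y -> E x y' ->
  halftree x y z -> halftree x y' z -> y = y'.
Proof.
rewrite /halftree /= => /dist_adjacent Ey /dist_adjacent Ey' h h';
  apply: (@between_unique x _ _ z).
all: rewrite /between; lia.
Qed.

(* A path of the tree is geodesic as soon as it does not backtrack. *)
Lemma between_local a b c e : between a b c -> between b c e -> b <> c -> between a b e.
Proof.
move=> b1 b2 ne; have [m [h1 h2 h3]] := median a b e.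
have [<- //|bm] := eqVneq m b.
have [|y [Ey dy]] := @next_exists b m; first by move=> e0; rewrite e0 eqxx in bm.
have [y' [Ey' dy']] := next_exists ne.
move: b1 b2 h1 h2 h3; rewrite /between => b1 b2 h1 h2 h3.
have ? := dist_adjacent Ey; have ? := dist_adjacent Ey'.
(* Here [y], towards [m], and [y'], towards [c], are both the first vertex after [b] on the way to
   [e]. Since [y] is also towards [a], this contradicts that [b] lies between [a] and [c]. *)
have e0 : y = y'.
  apply: (@between_unique b _ _ e); rewrite /between.
  - move: (dist_triangle b y e) (dist_triangle y m e); lia.
  - move: (dist_triangle b y' e) (dist_triangle y' c e); lia.
  - lia.
subst y'; move: (dist_triangle a y c) (dist_triangle a m y) (distC y m) (distC b
  m); lia.
Qed.

Lemma halftree_cross v x z z' : E v x -> halftree v x z -> halftree x v z' ->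
  dist z z' = dist z x + 1 + dist v z'.
Proof.
move=> Evx hz hz'; have ne : x <> v by move=> e; rewrite e irrE in Evx.
have ? := dist_adjacent Evx; have ? := distC x v.
have b : between z x z'.
  apply: (@between_local _ _ v) => //; rewrite /between.
  - by move: hz; rewrite /halftree /= (distC z v) (distC z x); lia.
  - by move: hz'; rewrite /halftree /=; lia.
by rewrite b hz'; lia.
Qed.

Lemma halftree_edge v x z z' : E v x -> E z z' -> halftree v x z -> halftree x v z' ->
  z = x /\ z' = v.
Proof.
move=> Evx Ez h h'; have := halftree_cross Evx h h'; rewrite dist_adjacent // => e.
by split; [apply: dist_eq0 | apply/esym/dist_eq0]; lia.
Qed.

Lemma halftree_two x y y' z z' : E x y -> E x y' -> y <> y' ->
  halftree x y z -> halftree x y' z' -> dist z z' = dist z x + dist x z'.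
Proof.
move=> Ey Ey' ne hz hz'.
have [h|h] := pselect (halftree x y z'); first by case: ne; apply: next_unique hz'.
rewrite (halftree_cross Ey hz (halftreeC Ey h)).
by move: hz; rewrite /halftree /= (distC z x) (distC z y); lia.
Qed.

Lemma halftree_neighbor x y y' : E x y -> E x y' -> y <> y' -> halftree y x y'.
Proof.
move=> Ey Ey' ne; apply: halftreeC => // h; apply: ne.
by move: h; rewrite /halftree /= dist_adjacent // => -[] /esym/dist_eq0.
Qed.

Lemma halftree_self v x : E v x -> halftree v x x.
Proof. by move=> Ev; rewrite /halftree /= distxx dist_adjacent. Qed.

Lemma halftree_opp v x : ~ halftree v x v.
Proof. by rewrite /halftree /= distxx. Qed.

Lemma halftree_nest q w p y z : E q w -> E p y -> halftree q w p -> halftree p y q ->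
  halftree y p z -> halftree q w z.
Proof.
move=> Eq Ep hp hq hz.
have e := halftree_cross Ep hq hz; move: hp hq; rewrite /halftree /= => hp hq.
have := adjacent_dist z Eq; have := dist_triangle w p z; have := distC q y.
have := distC q p; lia.
Qed.

(** * Convex sets and projections onto them *)

Definition convex (S : set V) :=
  forall x m z, S x -> S z -> between x m z -> S m.

Lemma halftree_convex v x : E v x -> convex (halftree v x).
Proof.
move=> Ev z1 m z2 h1 h2 b; apply: contrapT => /(halftreeC Ev) hm.
have := halftree_cross Ev h1 hm; have := halftree_cross Ev h2 hm; rewrite (distC z2 m).
by move: b (dist_triangle z1 x z2); rewrite /between (distC z2 x); lia.
Qed.

(** The gate is a point of [S] nearest to [x]: the median of [x], this point and [z] is in [S] by
    convexity and is no farther from [x]. *)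
Lemma gate_exists (S : set V) (x : V) : convex S -> (S !=set0)%classic ->
  exists2 y, S y & forall z, S z -> between x y z.
Proof.
move=> cS [s0 Ss0].
have ex : exists n, `[< exists2 s, S s & dist x s = n >].
  by exists (dist x s0); apply/asboolP; exists s0.
case: (ex_minnP ex) => n /asboolP[s Ss ds] min; exists s => // z Sz.
have [m [b1 b2 b3]] := median x s z.
suff -> : s = m by [].
have : n <= dist x m by apply: min; apply/asboolP; exists m => //; apply: cS b3.
by move=> le; apply/esym/dist_eq0; move: b2; rewrite /between; lia.
Qed.

Lemma gate_unique (S : set V) x y y' : S y -> S y' ->
  (forall z, S z -> between x y z) -> (forall z, S z -> between x y' z) -> y = y'.
Proof.
move=> Sy Sy' /(_ _ Sy') b /(_ _ Sy) b'; apply: dist_eq0.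
by move: b b'; rewrite /between (distC y' y); lia.
Qed.

(** * Oriented edges along geodesics, and the action of automorphisms *)

Definition edges x y := pairmap pair x (geodesic x y).

Lemma edges_cat x m z : between x m z -> edges x z = edges x m ++ edges m z.
Proof. by move=> /geodesic_between e; rewrite /edges e pairmap_cat geodesic_last. Qed.

Lemma edgesE x y : E x y -> edges x y = [:: (x, y)].
Proof. by move=> Exy; rewrite /edges geodesicE. Qed.

Lemma edgesxx x : edges x x = [::]. Proof. by rewrite /edges geodesicxx. Qed.

Definition swap (e : V * V) := (e.2, e.1).

Lemma edges_rev x y : edges y x = rev (map swap (edges x y)).
Proof.
rewrite /edges geodesic_rev -{1}[y](geodesic_last x).
move: (geodesic x y) => p; elim: p x => //= a p IH x;
  rewrite rev_cons -cats1 pairmap_cat IH.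
rewrite rev_cons -cats1; congr (_ ++ [:: (_, _)]).
case: p {IH} => //= b p; by rewrite rev_cons last_rcons.
Qed.

Lemma edges_mem x y e : e \in edges x y ->
  [/\ between x e.1 y, between x e.2 y & E e.1 e.2].
Proof.
move: {2}(dist x y).+1 (ltnSn (dist x y)) => n; elim: n x => // n IH x le.
have [<-|/eqP ne] := eqVneq x y; first by rewrite edgesxx.
have [x' [Ex dx]] := next_exists ne; have dx1 := dist_adjacent Ex.
have b : between x x' y by rewrite /between dx dx1.
rewrite (edges_cat b) edgesE // inE => /predU1P[->|/IH [|b1 b2 Ee]] //=.
  by split=> //; rewrite /between distxx.
  by lia.
split=> //; rewrite /between dx.
  by have := dist_triangle x e.1 y; have := dist_triangle x x' e.1; move: b1;
    rewrite /between; lia.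
by have := dist_triangle x e.2 y; have := dist_triangle x x' e.2; move: b2;
  rewrite /between; lia.
Qed.

Section Automorphism.
Variables (g : permutation V).
Hypothesis autg : automorphisms E g.

Lemma perm_inj : injective g. Proof. exact: can_inj (perm_funK g). Qed.

Lemma geodesic_aut x y : geodesic (g x) (g y) = map g (geodesic x y).
Proof.
apply: geodesic_eq; last by rewrite last_map geodesic_last.
have /andP[pp up] := geodesic_simple x y.
rewrite /simple_path -map_cons (map_inj_uniq perm_inj) up andbT path_map.
by rewrite (eq_path (e' := E)) // => a b /=; rewrite autg.
Qed.

Lemma dist_aut x y : dist (g x) (g y) = dist x y.
Proof. by rewrite /dist geodesic_aut size_map. Qed.

Lemma halftree_aut v x z : halftree (g v) (g x) (g z) = halftree v x z.
Proof. by rewrite /halftree /= !dist_aut. Qed.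

Lemma between_aut x y z : between (g x) (g y) (g z) = between x y z.
Proof. by rewrite /between !dist_aut. Qed.

Lemma edges_aut x y :
  edges (g x) (g y) = map (fun e => (g e.1, g e.2)) (edges x y).
Proof.
by rewrite /edges geodesic_aut; move: (geodesic x y) => p;
  elim: p x => //= a p IH x; rewrite IH.
Qed.

End Automorphism.

End TreeGeometry.

(** * Minimal actions *)

Section Subgroups.
Variable gT : groupType.
Local Open Scope group_scope.
Implicit Types (H S : set gT) (g h : gT).

Lemma subgroup1 H : subgroup_set H -> H 1.
Proof. by case=> /set_mem. Qed.

Lemma subgroupV H g : subgroup_set H -> H g -> H g^-1.
Proof. by move=> sH Hg; apply/set_mem/(group_closedV sH)/mem_set. Qed.

Lemma subgroupM H g h : subgroup_set H -> H g -> H h -> H (g * h).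
Proof. by move=> sH Hg Hh; apply/set_mem/(group_closedM sH); apply/mem_set. Qed.

Lemma subgroupX H g n : subgroup_set H -> H g -> H (g ^+ n).
Proof.
move=> sH Hg; elim: n => [|n IH]; first exact: subgroup1.
by rewrite expgS; apply: subgroupM.
Qed.

Lemma subgroupJ H g h : subgroup_set H -> H g -> H h -> H (g ^ h).
Proof.
move=> sH Hg Hh; rewrite conjgE; apply: (subgroupM sH); first exact: subgroupV.
exact: subgroupM.
Qed.

Lemma subgroup_intro H :
  H 1 -> (forall g h, H g -> H h -> H (g * h^-1)) -> subgroup_set H.
Proof.
move=> H1 HV; split; first exact/mem_set.
by move=> g h /set_mem Hg /set_mem Hh; apply/mem_set/HV.
Qed.

Lemma generated_is_subgroup S : subgroup_set (generated_subgroup S).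
Proof.
apply: subgroup_intro => [H [sH _]|g h Gg Gh H HS]; first exact: subgroup1.
by apply: subgroupM HS.1 (Gg H HS) (subgroupV HS.1 (Gh H HS)).
Qed.

Lemma generated_incl S g : S g -> generated_subgroup S g.
Proof. by move=> Sg H [_]; apply. Qed.

Lemma generated_min S H g : subgroup_set H -> (S `<=` H)%classic ->
  generated_subgroup S g -> H g.
Proof. by move=> sH SH; apply. Qed.

End Subgroups.

Section Permutations.
Variables (V : Type).
Implicit Types g h : permutation V.

Lemma permM g h x : (g * h)%g x = g (h x). Proof. by []. Qed.
Lemma perm1 x : (1 : permutation V)%g x = x. Proof. by []. Qed.
Lemma permK g x : (g^-1)%g (g x) = x. Proof. exact: perm_funK. Qed.
Lemma permKV g x : g ((g^-1)%g x) = x. Proof. exact: perm_invK. Qed.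

End Permutations.

(** * Occurrences of a pattern in a word *)

Section Occurrences.
Implicit Types P s : seq bool.

Fixpoint occurrences P s : nat :=
  if s is _ :: s' then prefix P s + occurrences P s' else 0.

Lemma occurrences_cons P a s :
  occurrences P (a :: s) = prefix P (a :: s) + occurrences P s.
Proof. by []. Qed.

Lemma occurrences_cat_ge P s1 s2 :
  occurrences P s1 + occurrences P s2 <= occurrences P (s1 ++ s2).
Proof.
elim: s1 => [|a s1 IH]; first by rewrite add0n.
rewrite cat_cons !occurrences_cons -addnA leq_add //.
have [/prefixP[r e]|//] := boolP (prefix P (a :: s1)).
by rewrite -cat_cons e -catA prefix_prefix.
Qed.

Lemma occurrences_cat_le P s1 s2 :
  occurrences P (s1 ++ s2) <= occurrences P s1 + occurrences P s2 + size P.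
Proof.
have short s : occurrences P (s ++ s2) <= size s + occurrences P s2.
  elim: s => // a s IH; rewrite cat_cons occurrences_cons addSn -add1n.
  by rewrite leq_add // leq_b1.
elim: s1 => [|a s1 IH]; first by rewrite leq_addr.
have [le|lt] := leqP (size P) (size (a :: s1)); last first.
  by move: (short (a :: s1)) lt; lia.
rewrite cat_cons !occurrences_cons !prefixE -cat_cons takel_cat //.
by rewrite -!addnA leq_add2l addnA.
Qed.

(** Each stretch of a geodesic between consecutive orbit points records a departure label and an
    arrival label, which are equal by [first_return]. *)
Definition double_letters s := flatten [seq [:: c; c] | c <- s].

(* Between consecutive letters [true], the doubled word has blocks of 2, 4 and
   6 letters [false]. The pattern reads the blocks 2 and 4 in this order, which
   never happens in a power of the reversed word. *)
Definition chiral_word :=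
  [:: true; false; true; false; false; true; false; false; false].
Definition chiral_pattern :=
  [:: true; false; false; true; true; false; false; false; false; true].

Lemma occurrences_chiral n :
  n <= occurrences chiral_pattern (flatten (nseq n (double_letters chiral_word))).
Proof.
by elim: n.
Qed.

Lemma occurrences_chiral_rev n :
  occurrences chiral_pattern
    (rev (flatten (nseq n (double_letters chiral_word)))) = 0.
Proof.
rewrite rev_flatten map_nseq rev_nseq.
set w := rev _.
(* The pattern is shorter than a period, so an occurrence starting in the first period ends in it or
   in the next one, and both cases are decided by computation. *)
have red s : s = [::] \/ (exists s', s = w ++ s') ->
    occurrences chiral_pattern (w ++ s) = occurrences chiral_pattern s.
  by case=> [->|[s' ->]].
elim: n => // n IH; rewrite -[RHS]IH; apply: red.
by case: n {IH} => [|n]; [left|right; exists (flatten (nseq n w))].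
Qed.

End Occurrences.

(** * Folding distances into colors *)

Section Fold.
Variable k : nat.
Hypothesis k_gt0 : 0 < k.

(* The zigzag 0, 1, ..., k, k - 1, ..., 1, 0, 1, ... *)
Definition zigzag n := let r := n %% (2 * k) in if r <= k then r else 2 * k - r.

Let modE n : (n.+1 %% (2 * k) = (n %% (2 * k)).+1 /\ (n %% (2 * k)).+1 < 2 * k) \/
  (n.+1 %% (2 * k) = 0 /\ (n %% (2 * k)).+1 = 2 * k).
Proof.
have K0 : 0 < 2 * k by lia.
have dv : (2 * k %| n.+1) = (2 * k %| (n %% (2 * k)).+1).
  by rewrite {1}(divn_eq n (2 * k)) -addnS dvdn_addr // dvdn_mull.
have := ltn_pmod n K0; rewrite leq_eqVlt => /orP[/eqP e|lt]; [right|left].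
  by rewrite modnS dv e dvdnn.
by rewrite modnS dv gtnNdvd.
Qed.

Lemma zigzag_le n : zigzag n <= k.
Proof. by rewrite /zigzag; move: (n %% _) => r; case: (leqP r k); clear; lia. Qed.

Lemma zigzagS n : zigzag n.+1 = (zigzag n).+1 \/ zigzag n = (zigzag n.+1).+1.
Proof.
rewrite /zigzag; case: (modE n) => -[-> h]; move: h; move: (n %% (2 * k)) => r.
  by case: (leqP r k); case: (leqP r.+1 k); lia.
by rewrite leq0n; case: (leqP r k); lia.
Qed.

Lemma zigzag_turn n : 0 < zigzag n.+1 < k ->
  (zigzag n = (zigzag n.+1).-1 /\ zigzag n.+2 = (zigzag n.+1).+1) \/
  (zigzag n = (zigzag n.+1).+1 /\ zigzag n.+2 = (zigzag n.+1).-1).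
Proof.
rewrite /zigzag; case: (modE n.+1) => -[-> h]; case: (modE n) => -[e h'].
all: rewrite ?e in h *; move: h h'; clear e; rewrite ?leq0n; move: (n %% (2 * k)) => r.
- by case: (leqP r k); case: (leqP r.+1 k); case: (leqP r.+2 k); lia.
- by case: (leqP r k); case: (leqP 1 k); lia.
- by case: (leqP r k); case: (leqP r.+1 k); lia.
- by lia.
Qed.

Lemma zigzag0 n : zigzag n = 0 -> 2 * k %| n.
Proof.
rewrite /zigzag /dvdn; have : n %% (2 * k) < 2 * k by rewrite ltn_pmod //; lia.
by move: (n %% _) => r; case: (leqP r k); lia.
Qed.

Lemma zigzag_max n : zigzag n = k -> n %% (2 * k) = k.
Proof.
have : n %% (2 * k) < 2 * k by rewrite ltn_pmod //; lia.
by rewrite /zigzag; move: (n %% _) => r; case: (leqP r k); lia.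
Qed.

Lemma zigzag_dvd n : k %| n -> zigzag n = 0 \/ zigzag n = k.
Proof.
have K0 : 0 < 2 * k by lia.
rewrite {1}(divn_eq n (2 * k)) dvdn_addr ?mulnA ?dvdn_mull //.
have := ltn_pmod n K0; rewrite /zigzag; move: (n %% (2 * k)) => r lt.
case/dvdnP=> q e; subst r; have q2 : q < 2 by rewrite -(ltn_pmul2r k_gt0).
by case: q q2 {lt} => [|[|]] //= _; [left|right]; rewrite ?mul0n ?mul1n ?leqnn.
Qed.

End Fold.

(** * Minimal actions of groups generated by elements fixing a vertex *)

Section MinimalAction.
Variable T : tree.
Local Notation V := (vertex T).
Local Notation E := (@adjacent T).
Variable gens : set (permutation V).
Local Notation G := (generated_subgroup gens).
Hypothesis autG : forall g, G g -> automorphisms E g.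
Hypothesis fix_gens : forall g, gens g -> exists x, g x = x.

Let sG := generated_is_subgroup gens.

(** By medians, distances are additive modulo 2, so the elements with even displacements form a
    subgroup. A generator fixing [u] displaces [x] by twice [dist x u] modulo 2. *)
Lemma even_displacement g x : G g -> ~~ odd (dist x (g x)).
Proof.
pose P : set (permutation V) := fun g => G g /\ forall x, ~~ odd (dist x (g x)).
have odd_add (a b c : V) : odd (dist a c) = odd (dist a b) (+) odd (dist b c).
  have [m [b1 b2 b3]] := median a b c; move: b1 b2 b3.
  by rewrite /between (distC b m); lia.
suff : (G `<=` P)%classic by move=> GP /GP [_ +]; apply.
move=> {}g; apply: generated_min => [|{x}{}g gg]; last first.
  have Gg : G g by apply: generated_incl.
  split=> // x; have [u gu] := fix_gens gg.
  rewrite (odd_add _ u) -{2}gu (dist_aut (autG Gg)) (distC u) addbb //.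
apply: subgroup_intro => [|g1 g2 [G1 P1] [G2 P2]].
  by split=> [|z]; [exact: (subgroup1 sG)|rewrite perm1 distxx].
split=> [|z]; first exact: (subgroupM sG G1 (subgroupV sG G2)).
rewrite (odd_add _ ((g2^-1)%g z)) permM (negPf (P1 _)) addbF distC.
by rewrite -{2}(permKV g2 z).
Qed.

Variables (S : set V).
Hypothesis convS : convex S.
Hypothesis invS : forall g x, G g -> S x -> S (g x).
Hypothesis minS : forall S' : set V, convex S' -> (S' !=set0)%classic ->
  (S' `<=` S)%classic -> (forall g x, G g -> S' x -> S' (g x)) ->
  (S `<=` S')%classic.
Hypothesis nofix : forall x, S x -> ~ (forall g, G g -> g x = x).

(** Otherwise the points of [S] whose whole orbit stays on the side of [q] form a nonempty invariant
    convex set that misses [w], against minimality. *)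
Lemma orbit_half p q w : S p -> S w -> E q w ->
  exists2 g, G g & halftree q w (g p).
Proof.
move=> Sp Sw Eq; apply: contrapT => none.
have Ew : E w q by rewrite adjacent_sym.
pose S' : set V := fun z => S z /\ forall g, G g -> halftree w q (g z).
suff /(_ _ Sw) [_ /(_ _ (subgroup1 sG)) /halftree_opp] : (S `<=` S')%classic by [].
apply: minS.
- move=> x m z [Sx hx] [Sz hz] b; split; first exact: convS Sx Sz b.
  move=> g Gg; apply: (halftree_convex Ew (hx g Gg) (hz g Gg)).
  by rewrite between_aut //; apply: autG.
- exists p; split=> // g Gg; apply: halftreeC => // h.
  by apply: none; exists g.
- by move=> z [].
- move=> g z Gg [Sz hz]; split; first exact: invS.
  by move=> h Gh; rewrite -permM; apply: hz; exact: (subgroupM sG).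
Qed.

Lemma neighbor_ex x : S x -> exists2 y, S y & E x y.
Proof.
move=> Sx; apply: contrapT => none; apply: (nofix Sx) => g Gg.
apply: contrapT => /nesym ne; apply: none.
have [y [Ey dy]] := next_exists ne; exists y => //.
by apply: (convS Sx (invS Gg Sx)); rewrite /between dy (dist_adjacent Ey).
Qed.

Lemma adjacent_not_orbit x y g : G g -> E x y -> g x <> y.
Proof.
by move=> Gg Ey e; have := even_displacement x Gg; rewrite e dist_adjacent.
Qed.

(** Some translate of [y] lies on the side of [x], and by parity it is not [x] itself; the step from
    [x] towards it is the second neighbor. *)
Lemma two_neighbors x y : S x -> S y -> E x y ->
  exists z, [/\ S z, E x z & y <> z].
Proof.
move=> Sx Sy Exy; have Eyx : E y x by rewrite adjacent_sym.
have [g Gg h] := orbit_half Sy Sx Eyx.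
have [|z [Ez dz]] := @next_exists _ x (g y).
  by move=> e; apply: (adjacent_not_orbit Gg Eyx).
exists z; split=> //.
  by apply: (convS Sx (invS Gg Sy)); rewrite /between dz (dist_adjacent Ez).
move=> e; subst z; move: h; rewrite /halftree /=; lia.
Qed.

(** * Signed counts of edge crossings *)

Section Cocycle.
Variable O : pred (V * V).
Hypothesis invO : forall g e, G g -> O (g e.1, g e.2) = O e.
Local Open Scope ring_scope.

(** Edges of [O] traversed backwards count negatively. Detours then cancel, which makes the count
    additive on arbitrary triples, not only along geodesics. *)
Definition crossings x y : int :=
  (count O (edges x y))%:Z - (count (O \o @swap T) (edges x y))%:Z.

Lemma crossings_rev x y : crossings y x = - crossings x y.
Proof.
rewrite /crossings edges_rev !count_rev !count_map.
rewrite (@eq_count _ (preim (@swap T) (O \o @swap T)) O); last by case.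
by rewrite GRing.opprB.
Qed.

Lemma crossings_add x y z : crossings x z = crossings x y + crossings y z.
Proof.
have [m [b1 b2 b3]] := median x y z.
have := crossings_rev m y; rewrite /crossings.
rewrite (edges_cat b1) (edges_cat b2) (edges_cat b3) !count_cat; lia.
Qed.

Lemma crossings_aut g x y : G g -> crossings (g x) (g y) = crossings x y.
Proof.
move=> Gg; rewrite /crossings (edges_aut (autG Gg)) !count_map.
rewrite (@eq_count _ _ O); last by move=> e /=; rewrite invO.
rewrite [X in _ - (Posz X)](@eq_count _ _ (O \o @swap T)) //.
by move=> -[a b] /=; exact: (invO (b, a)).
Qed.

Lemma crossings0 x : crossings x x = 0.
Proof. by rewrite /crossings edgesxx. Qed.

(* [g |-> crossings x (g x)] is a morphism to the integers, and it kills the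
   generators because they fix a vertex. *)
Lemma crossings_displacement g x : G g -> crossings x (g x) = 0.
Proof.
pose P : set (permutation V) := fun g => G g /\ forall x, crossings x (g x) = 0.
suff : (G `<=` P)%classic by move=> GP /GP [_ +]; apply.
move=> {}g; apply: generated_min => [|{x}{}g gg]; last first.
  have Gg : G g by apply: generated_incl.
  split=> // x; have [u gu] := fix_gens gg.
  rewrite (crossings_add _ u) -{2}gu crossings_aut //.
  by rewrite (crossings_rev x u) GRing.addrN.
apply: subgroup_intro => [|g1 g2 [G1 P1] [G2 P2]].
  by split=> [|z]; [exact: (subgroup1 sG)|rewrite perm1 crossings0].
split=> [|z]; first exact: (subgroupM sG G1 (subgroupV sG G2)).
rewrite (crossings_add _ ((g2^-1)%g z)) permM P1 GRing.addr0 crossings_rev.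
by rewrite -{2}(permKV g2 z) P2.
Qed.

End Cocycle.

(** * Labels met along geodesics through an orbit *)

Section Labels.
Variables b e1 : V.

Definition orbit x := exists2 g, G g & g b = x.

Definition label u v := `[< exists2 g, G g & g b = u /\ g e1 = v >].

Definition edge_trace (e : V * V) : seq bool :=
  (if `[< orbit e.1 >] then [:: label e.1 e.2] else [::]) ++
  (if `[< orbit e.2 >] then [:: label e.2 e.1] else [::]).

(* Each passage of the geodesic through the orbit of [b] records the labels of
   the direction of arrival and of the direction of departure. *)
Definition trace x y := flatten (map edge_trace (edges x y)).

Lemma orbit_aut g x : G g -> orbit (g x) <-> orbit x.
Proof.
move=> Gg; split=> -[h Gh e].
  by exists (g^-1 * h)%g;
    [exact: (subgroupM sG (subgroupV sG Gg))|rewrite permM e permK].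
by exists (g * h)%g; [exact: (subgroupM sG)|rewrite permM e].
Qed.

Lemma label_aut g u v : G g -> label (g u) (g v) = label u v.
Proof.
move=> Gg; apply/asboolP/asboolP => -[h Gh [eu ev]].
  exists (g^-1 * h)%g; first exact: (subgroupM sG (subgroupV sG Gg)).
  by rewrite !permM eu ev !permK.
by exists (g * h)%g; [exact: (subgroupM sG)|rewrite !permM eu ev].
Qed.

Lemma trace_cat x y z : between x y z -> trace x z = trace x y ++ trace y z.
Proof. by move=> bt; rewrite /trace (edges_cat bt) map_cat flatten_cat. Qed.

Lemma trace_aut g x y : G g -> trace (g x) (g y) = trace x y.
Proof.
move=> Gg; rewrite /trace (edges_aut (autG Gg)) -map_comp; congr flatten.
apply: eq_map => e; rewrite /edge_trace /= !label_aut //.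
by rewrite !(asbool_equiv_eq (orbit_aut _ Gg)).
Qed.

Lemma trace_rev x y : trace y x = rev (trace x y).
Proof.
rewrite /trace edges_rev rev_flatten map_rev -!map_comp; congr flatten.
congr rev; apply: eq_map => e; rewrite /edge_trace /= rev_cat.
by do 2!case: ifP.
Qed.

Hypothesis Sb : S b.

Lemma orbitS x : orbit x -> S x.
Proof. by case=> g Gg <-; apply: invS. Qed.

Lemma orbit_not_adjacent x y : orbit x -> orbit y -> ~ E x y.
Proof.
move=> [g Gg <-] [h Gh eh] Ey; have := adjacent_not_orbit (g := (h * g^-1)%g) _ Ey.
rewrite permM permK => /(_ _ eh); apply; exact: (subgroupM sG Gh (subgroupV sG Gg)).
Qed.

(** Take for [q] an orbit point nearest to [p] on the side of [y]; no orbit point lies strictly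
    between. Let [O] be the orbit of the oriented edge [(p, y)]. The signed count of crossings from
    [p] to [q] vanishes, yet [(p, y)] contributes 1. Edges of [O] start in the orbit of [b], so only
    the last edge read backwards can compensate: [(q, z)] is in [O], whence the equality of
    labels. *)
Lemma first_return p y : orbit p -> S y -> E p y ->
  exists q z, [/\ [/\ orbit q, S z & E q z],
    halftree p y q, dist p q = (dist p z).+1, label q z = label p y
    & trace p q = [:: label p y; label p y]].
Proof.
move=> op Sy Ey; have dy := dist_adjacent Ey.
have ex : exists n, `[< exists2 q, orbit q /\ halftree p y q & dist p q = n >].
  have [g Gg h] := orbit_half (orbitS op) Sy Ey.
  by exists (dist p (g p)); apply/asboolP; exists (g p) => //; split=> //;
    apply/orbit_aut.
case: (ex_minnP ex) => n /asboolP[q [oq hq] dq] min.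
have [|z [Ez]] := @next_exists _ q p.
  by move=> e; move: hq; rewrite e; apply: halftree_opp.
rewrite (distC q) (distC z) => dz; have dz1 := dist_adjacent Ez.
have Ez' : E z q by rewrite adjacent_sym.
have zp : z <> p by move=> e; apply: (orbit_not_adjacent oq op); rewrite -e.
have yq : y <> q by move=> e; apply: (orbit_not_adjacent op oq); rewrite -e.
have inside u : between p u q -> u <> p -> halftree p y u.
  move=> bu /nesym up; have [y' [Ey' dy']] := next_exists up.
  suff -> : y = y' by [].
  apply: (next_unique Ey Ey' hq); move: bu (dist_triangle y' u q) (adjacent_dist q Ey').
  by rewrite /between /halftree /=; lia.
have notorb u : between p u q -> u <> p -> u <> q -> ~ orbit u.
  move=> bu up uq ou; have : n <= dist p u.
    by apply: min; apply/asboolP; exists u => //; split=> //; apply: inside.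
  by move=> le; apply: uq; apply: dist_eq0; move: bu; rewrite /between; lia.
have bz : between p z q by rewrite /between (distC z) dz1; lia.
have hz := inside z bz zp.
have by_ : between p y q by rewrite /between hq dy.
have bz' : between y z q.
  by move: hz hq; rewrite /between /halftree /= (distC z q) dz1; lia.
have ed : edges p q = (p, y) :: edges y z ++ [:: (z, q)].
  by rewrite (edges_cat by_) (edges_cat bz') (edgesE Ey) (edgesE Ez').
have midorb u : between y u z -> ~ orbit u.
  move=> bu; have hy : halftree p y q := hq.
  have bpu : between p u q.
    move: bu hq hz (dist_triangle p u q) (dist_triangle u z q) (dist_triangle p y u).
    by rewrite /between /halftree /= (distC z q) dz1 dy; lia.
  apply: notorb => // e; subst u; move: bu hz hq; rewrite /between /halftree /=.
    by rewrite (distC y p) dy; lia.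
  by rewrite dz1; lia.
have oy : ~ orbit y by apply: midorb; rewrite /between distxx.
have oz : ~ orbit z by apply: midorb; rewrite /between distxx addn0.
pose O : pred (V * V) := fun e => `[< exists2 g, G g & g p = e.1 /\ g y = e.2 >].
have O1 e : O e -> orbit e.1.
  by move=> /asboolP[g Gg [<- _]]; apply/orbit_aut.
have invO g e : G g -> O (g e.1, g e.2) = O e.
  move=> Gg; apply/asboolP/asboolP => -[h Gh /= [eu ev]].
    exists (g^-1 * h)%g; first exact: (subgroupM sG (subgroupV sG Gg)).
    by rewrite !permM eu ev !permK.
  by exists (g * h)%g; [exact: (subgroupM sG)|rewrite !permM eu ev].
have [g Gg gp] : exists2 g, G g & g p = q.
  have [[g Gg gp] [h Gh hq']] := (op, oq); exists (h * g^-1)%g.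
    exact: (subgroupM sG Gh (subgroupV sG Gg)).
  by rewrite permM -gp permK.
have := crossings_displacement invO p Gg; rewrite gp /crossings ed /= !count_cat /=.
have -> : count O (edges y z) = 0.
  apply/eqP; rewrite -leqn0 leqNgt -has_count; apply/hasPn => e /edges_mem[b1 b2 _].
  by apply/negP => /O1; apply: midorb.
have -> : count (O \o @swap T) (edges y z) = 0.
  apply/eqP; rewrite -leqn0 leqNgt -has_count; apply/hasPn => e /edges_mem[b1 b2 _].
  by apply/negP => /O1; apply: midorb.
have -> : O (p, y) by apply/asboolP; exists 1%g; [exact: (subgroup1 sG)|].
have -> : O (z, q) = false by apply/negP => /O1.
have -> : O (swap (p, y)) = false by apply/negP => /O1.
case Oz: (O _) => // _; move/asboolP: Oz => [h Gh /= [hp hy]].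
have lz : label q z = label p y by rewrite -hp -hy label_aut.
exists q, z; split=> //; first by split=> //; apply: convS (orbitS op) (orbitS oq) bz.
have mid0 : flatten [seq edge_trace i | i <- edges y z] = [::].
  apply/eqP; rewrite -size_eq0 size_flatten sumnE big_map big_map big_seq big1 //.
  move=> e /edges_mem[b1 b2 _]; rewrite /edge_trace.
  by rewrite (asboolF (midorb _ b1)) (asboolF (midorb _ b2)).
rewrite /trace ed /= map_cat flatten_cat /= mid0 /edge_trace /=.
by rewrite lz (asboolT op) (asboolT oq) (asboolF oy) (asboolF oz).
Qed.

End Labels.

Lemma geodesic_extend q y q1 z1 y2 q2 :
  E q y -> E q1 z1 -> E q1 y2 -> z1 <> y2 -> halftree q y q1 ->
  dist q q1 = (dist q z1).+1 -> halftree q1 y2 q2 ->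
  between q q1 q2 /\ halftree q y q2.
Proof.
move=> Ey Ez1 Ey2 ne h1 dz h2.
have hz : halftree q1 z1 q by rewrite /halftree /= (distC q1) (distC z1).
have e := halftree_two Ez1 Ey2 ne hz h2; split=> //.
move: h1 (dist_triangle y q1 q2) (adjacent_dist q2 Ey); rewrite /halftree /=; lia.
Qed.

(** * A quasimorphism excluding bounded simplicity *)

Section Chirality.
Variables b e1 e2 e3 : V.
Hypotheses (Sb : S b) (Se1 : S e1) (Se2 : S e2) (Se3 : S e3).
Hypotheses (Ee1 : E b e1) (Ee2 : E b e2) (Ee3 : E b e3) (e23 : e2 <> e3).
Hypothesis ne2 : ~ exists2 g, G g & g b = b /\ g e1 = e2.
Hypothesis ne3 : ~ exists2 g, G g & g b = b /\ g e1 = e3.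

Local Notation label := (label b e1).
Local Notation trace := (trace b e1).
Local Notation orbit := (orbit b).

(** At each orbit point the translate of [e1] is labelled [true], and those of [e2] and [e3] are two
    directions labelled [false], of which at least one differs from [z]. After [true] the letter
    [true] is excluded, because [z] may be the only direction with that label. *)
Lemma label_next q z c : orbit q -> label q z = c -> forall c', ~~ (c && c') ->
  exists y, [/\ S y, E q y, z <> y & label q y = c'].
Proof.
move=> [g Gg <-] lz [] nc.
  have l1 : label (g b) (g e1) by rewrite label_aut //; apply/asboolP; exists 1%g;
    [exact: (subgroup1 sG)|].
  exists (g e1); split=> //; [exact: invS|by rewrite autG| ].
  by move=> e; move: nc; rewrite -lz e l1.
have l2 : label (g b) (g e2) = false by rewrite label_aut //; apply/asboolP.
have l3 : label (g b) (g e3) = false by rewrite label_aut //; apply/asboolP.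
have [e|ne] := eqVneq z (g e2).
  exists (g e3); split=> //; [exact: invS|by rewrite autG| ].
  by rewrite e => /perm_inj.
by exists (g e2); split=> //; [exact: invS|by rewrite autG|apply/eqP].
Qed.

Lemma labelled_path c l q y : path (fun u v => ~~ (u && v)) c l ->
  orbit q -> S y -> E q y -> label q y = c ->
  exists q' z, [/\ [/\ orbit q', S z & E q' z], halftree q y q',
    dist q q' = (dist q z).+1, label q' z = last c l
    & trace q q' = double_letters (c :: l)].
Proof.
elim: l c q y => [|c' l IH] c q y /=.
  move=> _ oq Sy Ey <-; exact: first_return.
move=> /andP[cc' pl] oq Sy Ey lab.
have [q1 [z1 [[oq1 Sz1 Ez1] h1 dz1 l1 t1]]] := first_return e1 Sb oq Sy Ey.
have [y2 [Sy2 Ey2 ne l2]] := label_next oq1 (etrans l1 lab) cc'.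
have [q' [z [[oq' Sz Ez] h2 dz l' t2]]] := IH _ _ _ pl oq1 Sy2 Ey2 l2.
have [bt h] := geodesic_extend Ey Ez1 Ey2 ne h1 dz1 h2.
exists q', z; split=> //.
  by move: dz bt (adjacent_dist q Ez) (dist_triangle q q1 z);
    rewrite /between (distC q' q) (distC z q); clear; lia.
by rewrite (trace_cat b e1 bt) t1 t2 lab.
Qed.

(** The path spelling [chiral_word] from [b] ends at some [t b]. It arrives with label [false] while
    [t e1] has label [true], so the translates of this path by the powers of [t] concatenate without
    backtracking. *)
Lemma chiral_translation : exists2 t, G t &
  forall n, trace b ((t ^+ n)%g b) = flatten (nseq n (double_letters chiral_word)).
Proof.
have ob : orbit b by exists 1%g; [exact: (subgroup1 sG)|].
have lb : label b e1 = true by apply/asboolP; exists 1%g; [exact: (subgroup1 sG)|].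
have [//|q [z [[[t Gt tb] Sz Ez] h dz lz tr]]] :=
  @labelled_path true (behead chiral_word) b e1 _ ob Se1 Ee1 lb.
exists t => // n.
suff [] : (0 < n -> halftree b e1 ((t ^+ n)%g b)) /\
  trace b ((t ^+ n)%g b) = flatten (nseq n (double_letters chiral_word)) by [].
elim: n => [|[|n] [IH1 IH2]]; first by rewrite /trace edgesxx.
  by rewrite expg1 tb tr; split.
rewrite expgS permM; set x := (t ^+ n.+1)%g b in IH1 IH2 *.
have ne : z <> t e1.
  move=> e; move: lz; rewrite -tb e label_aut // lb //.
have h2 : halftree q (t e1) (t x) by rewrite -tb (halftree_aut (autG Gt)); apply: IH1.
have Et : E q (t e1) by rewrite -tb autG.
have [bt ht] := geodesic_extend Ee1 Ez Et ne h dz h2.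
by split=> //; rewrite (trace_cat b e1 bt) tr -tb trace_aut // IH2.
Qed.

Local Open Scope ring_scope.

Definition chirality x y : int :=
  (occurrences chiral_pattern (trace x y))%:Z
  - (occurrences chiral_pattern (trace y x))%:Z.

Lemma chirality_rev x y : chirality y x = - chirality x y.
Proof. by rewrite /chirality GRing.opprB. Qed.

Lemma chirality_aut g x y : G g -> chirality (g x) (g y) = chirality x y.
Proof. by move=> Gg; rewrite /chirality !trace_aut. Qed.

(** Cutting at [y] loses only the occurrences straddling it, at most 10, the length of the pattern,
    in each orientation; the two losses have opposite signs. *)
Lemma chirality_between x y z : between x y z ->
  `|chirality x z - chirality x y - chirality y z| <= 10.
Proof.
move=> bt; rewrite /chirality (trace_cat b e1 bt) (trace_cat b e1 (betweenC bt)).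
set P := chiral_pattern.
have := occurrences_cat_ge P (trace x y) (trace y z).
have := occurrences_cat_le P (trace x y) (trace y z).
have := occurrences_cat_ge P (trace z y) (trace y x).
have := occurrences_cat_le P (trace z y) (trace y x).
rewrite [size P]/=; lia.
Qed.

(** Cutting the three sides at the median costs 10 each, and the six pieces cancel by
    antisymmetry. *)
Lemma chirality_add x y z :
  `|chirality x z - chirality x y - chirality y z| <= 30.
Proof.
have [m [b1 b2 b3]] := median x y z.
have := chirality_between b1; have := chirality_between b2; have :=
  chirality_between b3.
have := chirality_rev m y; lia.
Qed.

Definition displaced_chirality (g : permutation V) := chirality b (g b).

Lemma chirality_mul g h : G g -> G h ->
  `|displaced_chirality (g * h)%g - displaced_chirality g - displaced_chirality h|
    <= 30.
Proof.
move=> Gg Gh; rewrite /displaced_chirality permM -(chirality_aut b (h b) Gg).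
exact: chirality_add.
Qed.

Lemma chirality_inv g : G g -> displaced_chirality g^-1%g = - displaced_chirality g.
Proof.
move=> Gg; rewrite /displaced_chirality -chirality_rev -(chirality_aut _ _ Gg).
by rewrite permKV.
Qed.

Lemma chirality_conj g u : G g -> G u ->
  `|displaced_chirality (g ^ u)%g - displaced_chirality g| <= 60.
Proof.
move=> Gg Gu; rewrite conjgE.
have Gu' : G u^-1%g by exact: (subgroupV sG).
have Ggu : G (g * u)%g by exact: (subgroupM sG).
have := chirality_mul Gu' Ggu; have := chirality_mul Gg Gu.
have aux (i u1 g1 w c : int) : i = - u1 -> `|w - g1 - u1| <= 30 ->
  `|c - i - w| <= 30 -> `|c - g1| <= 60 by lia.
exact: aux (chirality_inv Gu).
Qed.

Lemma not_boundedly_simple : ~ boundedly_simple G.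
Proof.
case=> N bs; have [t Gt tr] := chiral_translation.
have phit n : n%:Z <= displaced_chirality (t ^+ n)%g.
  rewrite /displaced_chirality /chirality [trace _ b]trace_rev tr
    occurrences_chiral_rev.
  have := occurrences_chiral n; clear; lia.
have phi1 : displaced_chirality 1%g = 0 by rewrite /displaced_chirality /chirality
  perm1 GRing.subrr.
have Gtn n : G (t ^+ n)%g by exact: (subgroupX n sG Gt).
have tn1 n : (t ^+ n.+1)%g <> 1%g.
  by move=> e; have := phit n.+1; rewrite e phi1.
(* [C] bounds the chirality of each conjugate of [t] and its inverse, and every factor adds an error
   of 30. The exponent chosen below is one more than the resulting bound for [N] factors. *)
pose C : int := `|displaced_chirality t| + 60.
have [s [szs ss e]] := bs t _ Gt (tn1 0%N) (Gtn _) (tn1 (absz (N%:Z * (C + 30)))).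
have phis : forall r : seq (permutation V), {subset r <= s} ->
    G (\prod_(k <- r) k)%g /\ `|displaced_chirality (\prod_(k <- r) k)%g| <= (size
      r)%:Z * (C + 30).
  elim=> [|k r IH] sub.
    by rewrite big_nil phi1; split=> //; exact: (subgroup1 sG).
  have [|Gr br] := IH; first by move=> x xr; apply: sub; rewrite inE xr orbT.
  have [u Gu ku] := ss k (sub k (mem_head _ _)).
  have [Gk bk] : G k /\ `|displaced_chirality k| <= C.
    case: ku => ->.
      split; first exact: (subgroupJ sG).
      have := chirality_conj Gt Gu; rewrite /C; lia.
    have Gt' : G t^-1%g by exact: (subgroupV sG).
    split; first exact: (subgroupJ sG).
    have := chirality_conj Gt' Gu; have := chirality_inv Gt; rewrite /C; lia.
  rewrite big_cons; split; first exact: (subgroupM sG).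
  have := chirality_mul Gk Gr;
    rewrite /= -[(size r).+1]addn1 PoszD GRing.mulrDl GRing.mul1r.
  have aux (x y z c X : int) : `|x| <= c -> `|y| <= X -> `|z - x - y| <= 30 ->
    `|z| <= X + (c + 30) by lia.
  exact: aux bk br.
have C0 : 0 <= C + 30 by rewrite /C; lia.
have [_] := phis s (fun _ => id); rewrite -e.
have aux (m n : nat) (c x : int) : (m <= n)%N -> 0 <= c ->
    (absz (n%:Z * c)).+1%:Z <= x -> `|x| <= m%:Z * c -> False.
  move=> mn c0; have : m%:Z * c <= n%:Z * c by nia.
  lia.
exact: aux szs C0 (phit _).
Qed.

End Chirality.

(** * Transitivity of stabilizers of branching vertices *)

Hypothesis bsG : boundedly_simple G.
Hypothesis S_neq0 : (S !=set0)%classic.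

Definition branching x := exists y1 y2 y3,
  [/\ [/\ S y1, S y2 & S y3], [/\ E x y1, E x y2 & E x y3]
    & [/\ y1 <> y2, y1 <> y3 & y2 <> y3]].

(** If [y] and [y'] are inequivalent, take a third direction [w]. If [y] is equivalent to [w], then
    [y'] is equivalent to neither of them; otherwise [y] is equivalent to neither [y'] nor [w].
    Either way [not_boundedly_simple] applies. *)
Lemma local_transitivity b y y' : S b -> branching b -> S y -> S y' ->
  E b y -> E b y' -> exists2 g, G g & g b = b /\ g y = y'.
Proof.
move=> Sb [y1 [y2 [y3 [[S1 S2 S3] [E1 E2 E3] [n12 n13 n23]]]]] Sy Sy' Ey Ey'.
apply: contrapT => ne.
have yy' : y <> y'.
  by move=> e; apply: ne; exists 1%g; [exact: (subgroup1 sG)|rewrite e].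
have [w [Sw Ew wy wy']] : exists w, [/\ S w, E b w, w <> y & w <> y'].
  have [e1|/eqP ne1] := eqVneq y1 y; have [e1'|/eqP ne1'] := eqVneq y1 y'.
  - by case: yy'; rewrite -e1.
  - have [e2|/eqP ne2] := eqVneq y2 y'.
      by exists y3; split=> //; congruence.
    by exists y2; split=> //; congruence.
  - have [e2|/eqP ne2] := eqVneq y2 y.
      by exists y3; split=> //; congruence.
    by exists y2; split=> //; congruence.
  - by exists y1.
have [[g Gg [gb gy]]|nw] := pselect (exists2 g, G g & g b = b /\ g y = w).
  apply: (@not_boundedly_simple b y' y w) => //; first by move=> /esym.
  - move=> [h Gh [hb hy]]; apply: ne; exists h^-1%g; first exact: (subgroupV sG).
    by rewrite -{1}hb -{1}hy !permK.
  - move=> [h Gh [hb hy]]; apply: ne; exists (h^-1 * g)%g.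
      exact: (subgroupM sG (subgroupV sG Gh)).
    by rewrite !permM gb gy -hy permK -{1}hb permK.
by apply: (@not_boundedly_simple b y y' w) => //; apply: nesym.
Qed.

(** The gate in [S] of a fixed vertex is itself fixed, since gates are unique. *)
Lemma fix_gens_S g : gens g -> exists2 x, S x & g x = x.
Proof.
move=> gg; have Gg : G g by apply: generated_incl.
have [u gu] := fix_gens gg; have [x Sx gx] := gate_exists u convS S_neq0.
exists x => //; apply: (gate_unique (invS Gg Sx) Sx _ gx) => z Sz.
rewrite -gu -(permKV g z) (between_aut (autG Gg)); apply: gx.
apply: invS => //; exact: (subgroupV sG).
Qed.

Lemma branching_median x y z m : S x -> S y -> S z ->
  between x m y -> between y m z -> between x m z -> m <> x -> m <> y -> m <> z ->
  S m /\ branching m.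
Proof.
move=> Sx Sy Sz b1 b2 b3 mx my mz.
have Sm : S m := convS Sx Sy b1; split=> //.
have [x' [Ex dx]] := next_exists mx; have [y' [Ey dy]] := next_exists my.
have [z' [Ez dz]] := next_exists mz.
have bt u v : dist m u = (dist v u).+1 -> E m v -> between m v u.
  by move=> e Ev; rewrite /between e (dist_adjacent Ev).
exists x', y', z'; split=> //.
- split; [exact: convS Sm Sx (bt _ _ dx Ex)|exact: convS Sm Sy (bt _ _ dy Ey)|].
  exact: convS Sm Sz (bt _ _ dz Ez).
move: b1 b2 b3; rewrite /between (distC x m) (distC y m) => b1 b2 b3.
split=> e; subst.
- by have := dist_triangle x y' y; rewrite (distC x y'); clear -b1 dx dy; lia.
- by have := dist_triangle x z' z; rewrite (distC x z'); clear -b3 dx dz; lia.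
- by have := dist_triangle y z' z; rewrite (distC y z'); clear -b2 dy dz; lia.
Qed.

Lemma convex_ind (P : V -> Prop) x : S x -> P x ->
  (forall u v, S u -> S v -> E u v -> P u -> P v) -> forall z, S z -> P z.
Proof.
move=> Sx Px step z; have [n e] : exists n, dist x z = n by exists (dist x z).
elim: n z e => [|n IH] z e Sz; first by rewrite -(dist_eq0 e).
have [|u [Eu du]] := @next_exists _ z x; first by move=> e'; rewrite e' distxx in e.
rewrite (distC z x) (distC u x) in du.
have Su : S u by apply: (convS Sx Sz);
  rewrite /between du (distC u z) (dist_adjacent Eu) addn1.
by apply: (step u z) => //; [rewrite adjacent_sym|apply: IH => //; lia].
Qed.

(** * Exclusion of the line *)

Section Line.
Local Open Scope ring_scope.
Hypothesis line : forall x, S x -> ~ branching x.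
Variables x0 y0 : V.
Hypotheses (Sx0 : S x0) (Sy0 : S y0) (Ey0 : E x0 y0).

(** An integer coordinate on the line [S], with [x0] at 0 and [y0] at 1. *)
Definition position z : int :=
  if `[< halftree x0 y0 z >] then (dist x0 z)%:Z else - (dist x0 z)%:Z.

(** Two distinct vertices with the same coordinate have a median with [x0] that branches, unless
    this median is [x0]. In that case both lie on the side away from [y0], and [x0] branches towards
    [y0] and both of them. *)
Lemma position_inj z z' : S z -> S z' -> position z = position z' -> z = z'.
Proof.
have Ex0 : E y0 x0 by rewrite adjacent_sym.
move=> Sz Sz' e; apply: contrapT => ne.
have [m [b1 b2 b3]] := median x0 z z'.
have [hz hz'] : dist x0 z = dist x0 z' /\ (halftree x0 y0 z <-> halftree x0 y0 z').
  move: e; rewrite /position; case: asboolP => h; case: asboolP => h' e.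
  - by split=> //; lia.
  - have [e1 e2] : dist x0 z = 0%N /\ dist x0 z' = 0%N by lia.
    by case: ne; rewrite -(dist_eq0 e1) -(dist_eq0 e2).
  - have [e1 e2] : dist x0 z = 0%N /\ dist x0 z' = 0%N by lia.
    by case: ne; rewrite -(dist_eq0 e1) -(dist_eq0 e2).
  - by split=> //; lia.
have mz : m <> z.
  move=> e'; subst m; apply: ne; apply: dist_eq0.
  by move: b1; rewrite /between hz; clear; lia.
have mz' : m <> z'.
  move=> e'; subst m; apply: ne; apply/dist_eq0.
  by move: b2; rewrite /between hz (distC z' z); clear; lia.
have [mx|/eqP mx] := eqVneq m x0; last first.
  by have [Sm] := branching_median Sx0 Sz Sz' b2 b3 b1 mx mz mz'; apply: line.
subst m; have [h|h] := pselect (halftree x0 y0 z).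
  have := halftree_convex Ey0 h (hz'.1 h) b3; exact: halftree_opp.
have h' : ~ halftree x0 y0 z' by move=> /hz'.
have bt u : ~ halftree x0 y0 u -> between y0 x0 u.
  by move=> /(halftreeC Ey0); rewrite /between /halftree /= (dist_adjacent Ex0).
have [|Sm] := branching_median Sy0 Sz Sz' (bt _ h) b3 (bt _ h') _ mz mz'.
  by move=> e'; move: Ey0; rewrite e' adjacent_irr.
exact: line.
Qed.

Lemma position_adjacent u v : E u v -> `|position v - position u| = 1.
Proof.
move=> Euv; have Ex0 : E y0 x0 by rewrite adjacent_sym.
have cross a c : E a c -> halftree x0 y0 a -> ~ halftree x0 y0 c ->
    a = y0 /\ c = x0.
  by move=> Ea ha /(halftreeC Ey0) hc; apply: (halftree_edge Ey0 Ea).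
rewrite /position; case: asboolP => hv; case: asboolP => hu.
- have := adjacent_dist x0 Euv; rewrite (distC u) (distC v); clear; lia.
- have Evu : E v u by rewrite adjacent_sym.
  by have [-> ->] := cross _ _ Evu hv hu; rewrite distxx (dist_adjacent Ey0).
- by have [-> ->] := cross _ _ Euv hu hv; rewrite distxx (dist_adjacent Ey0).
- have := adjacent_dist x0 Euv; rewrite (distC u) (distC v); clear; lia.
Qed.

Lemma position_step u v w : S u -> S w -> E u v -> E v w -> u <> w ->
  position w - position v = position v - position u.
Proof.
move=> Su Sw /position_adjacent h1 /position_adjacent h2 ne.
have : position u <> position w by move=> /(position_inj Su Sw).
by clear -h1 h2; lia.
Qed.

Definition acts_with_sign (eps : int) (g : permutation V) :=
  forall u v, S u -> S v -> E u v ->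
    position (g v) - position (g u) = eps * (position v - position u).

(** The sign is read on the edge from [x0] to [y0]. It propagates from edge to adjacent edge because
    the coordinate keeps its direction along a path that does not backtrack, both before and after
    applying [g]. *)
Lemma sign_exists g : G g ->
  exists2 eps, eps = 1 \/ eps = -1 & acts_with_sign eps g.
Proof.
move=> Gg; have p0 : position y0 - position x0 = 1.
  rewrite /position asboolT ?(dist_adjacent Ey0) //; last exact: halftree_self.
  by rewrite asboolF ?distxx //; apply: halftree_opp.
have Eg : E (g x0) (g y0) by rewrite (autG Gg).
exists (position (g y0) - position (g x0)).
  by have := position_adjacent Eg; clear; lia.
set eps := (X in acts_with_sign X) => u v Su; move: u Su v.
pose P u := forall v, S v -> E u v ->
  position (g v) - position (g u) = eps * (position v - position u).
suff : forall u, S u -> P u by [].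
have Pstep u v : S u -> S v -> E u v -> 
    position (g v) - position (g u) = eps * (position v - position u) -> P v.
  move=> Su Sv Euv e w Sw Evw; have [<-|/eqP ne] := eqVneq u w.
    by rewrite -GRing.opprB e -GRing.mulrN GRing.opprB.
  rewrite (position_step Su Sw Euv Evw ne) -e; apply: position_step.
  - exact: invS.
  - exact: invS.
  - by rewrite (autG Gg).
  - by rewrite (autG Gg).
  - by move=> /perm_inj.
apply: (convex_ind Sx0) => [|u v Su Sv Euv Pu]; last first.
  by apply: (Pstep u v) => //; apply: Pu.
apply: (Pstep y0) => //; first by rewrite adjacent_sym.
by rewrite -GRing.opprB -[in RHS]GRing.opprB p0 GRing.mulrN GRing.mulr1.
Qed.

Lemma sign_mul e1 e2 g h : G g -> G h ->
  acts_with_sign e1 g -> acts_with_sign e2 h -> acts_with_sign (e1 * e2) (g * h)%g.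
Proof.
move=> Gg Gh s1 s2 u v Su Sv Euv; rewrite !permM s1; last by rewrite (autG Gh).
- by rewrite s2 // GRing.mulrA.
- exact: invS.
- exact: invS.
Qed.

Lemma sign_unique g : acts_with_sign 1 g -> acts_with_sign (-1) g -> False.
Proof.
move=> /(_ _ _ Sx0 Sy0 Ey0) e1 /(_ _ _ Sx0 Sy0 Ey0); rewrite e1 {e1}.
by have := position_adjacent Ey0; clear; lia.
Qed.

Lemma sign_one : acts_with_sign 1 1%g.
Proof. by move=> u v _ _ _; rewrite !perm1 GRing.mul1r. Qed.

Lemma sign_inv eps g : G g -> eps = 1 \/ eps = -1 -> acts_with_sign eps g ->
  acts_with_sign eps g^-1%g.
Proof.
move=> Gg he sg; have Gg' : G g^-1%g by exact: (subgroupV sG).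
have [e1 he1 s1] := sign_exists Gg'; suff -> : eps = e1 by [].
have := sign_mul Gg Gg' sg s1; rewrite mulgV.
case: he => e; case: he1 => e1'; subst => // h; exfalso.
  by apply: (sign_unique sign_one); rewrite GRing.mul1r in h.
by apply: (sign_unique sign_one); rewrite GRing.mulr1 in h.
Qed.

Lemma sign_fix g x : acts_with_sign 1 g -> G g -> S x -> g x = x ->
  forall z, S z -> g z = z.
Proof.
move=> sg Gg Sx gx z Sz; apply: position_inj => //; first exact: invS.
move: z Sz; apply: (convex_ind Sx) => [|u v Su Sv Euv e]; first by rewrite gx.
by have := sg u v Su Sv Euv; rewrite e; clear; lia.
Qed.

Lemma line_false : False.
Proof.
(* A generator of sign 1 fixes a vertex of [S], hence all of [S]. So a generator that moves [x] has
   sign -1, and one exists because [G] does not fix [x]. *)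
have reflection x : S x -> exists a, [/\ gens a, acts_with_sign (-1) a & a x <> x].
  move=> Sx; apply: contrapT => none; apply: (nofix Sx) => g.
  pose P : set (permutation V) := fun g => g x = x.
  suff : (G `<=` P)%classic by apply.
  move=> {}g; apply: generated_min => [|{}g gg]; last first.
    have Gg : G g by apply: generated_incl.
    apply: contrapT => gx; apply: none; exists g; split=> //.
    have [eps [] -> // sg] := sign_exists Gg.
    have [y Sy gy] := fix_gens_S gg.
    by case: gx; apply: sign_fix sg Gg Sy gy _ Sx.
  apply: subgroup_intro => [|g1 g2 P1 P2]; first exact: perm1.
  by rewrite /P permM -{1}P2 permK.
have [a [ga sa ax0]] := reflection _ Sx0.
have Ga : G a by apply: generated_incl.
have [x Sx ax] := fix_gens_S ga; have [c [gc sc cx]] := reflection _ Sx.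
have Gc : G c by apply: generated_incl.
have Gt : G (a * c)%g by exact: (subgroupM sG).
have st : acts_with_sign 1 (a * c)%g by exact: (sign_mul Ga Gc sa sc).
have t1 : (a * c)%g <> 1%g.
  by move=> e; apply: cx; apply: (@perm_inj _ a); rewrite -permM e perm1 ax.
have a1 : a <> 1%g by move=> e; apply: ax0; rewrite e perm1.
have [N bs] := bsG; have [s [_ ss ea]] := bs _ _ Gt t1 Ga a1.
suff : G (\prod_(k <- s) k)%g /\ acts_with_sign 1 (\prod_(k <- s) k)%g.
  by rewrite -ea => -[_ s1]; apply: sign_unique s1 sa.
elim: s ss {ea} => [|k s IH] ss.
  by rewrite big_nil; split; [exact: (subgroup1 sG)|exact: sign_one].
rewrite big_cons; have [|Gs ssg] := IH.
  by move=> k' k's; apply: ss; rewrite inE k's orbT.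
have [u Gu ku] := ss k (mem_head _ _).
have [Gk sk] : G k /\ acts_with_sign 1 k.
  have conj (g : permutation V) : G g -> acts_with_sign 1 g ->
      G (g ^ u)%g /\ acts_with_sign 1 (g ^ u)%g.
    move=> Gg sg; split; first exact: (subgroupJ sG).
    have Gu' : G u^-1%g by exact: (subgroupV sG).
    have [eps he su] := sign_exists Gu; have su' := sign_inv Gu he su.
    have := sign_mul Gu' (subgroupM sG Gg Gu) su' (sign_mul Gg Gu sg su).
    by rewrite conjgE GRing.mul1r; case: he => ->.
  by case: ku => ->; apply: conj => //;
    [exact: (subgroupV sG)|apply: sign_inv => //; left].
by split; [exact: (subgroupM sG)|exact: (sign_mul Gk Gs sk ssg)].
Qed.

End Line.

(** * Spacing of the branching vertices *)

Lemma branching_exists : exists2 x, S x & branching x.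
Proof.
apply: contrapT => none; have [x0 Sx0] := S_neq0.
have [y0 Sy0 Ey0] := neighbor_ex Sx0.
apply: (line_false _ Sx0 Sy0 Ey0) => x Sx bx; apply: none; by exists x.
Qed.

Lemma branching_aut g x : G g -> branching x -> branching (g x).
Proof.
move=> Gg [y1 [y2 [y3 [[S1 S2 S3] [E1 E2 E3] [n12 n13 n23]]]]].
exists (g y1), (g y2), (g y3); split; first by split; apply: invS.
  by rewrite !(autG Gg).
by split=> /perm_inj.
Qed.

(** Local transitivity provides [g] fixing [p] and matching the first steps towards [a] and [c]. If
    [g a] were not [c], the geodesics from [p] to them would part at a branching vertex too close to
    [p] for [far]. *)
Lemma stabilizer_turn p a c : S p -> branching p -> S a -> S c -> 0 < dist p a ->
  dist p a = dist p c ->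
  (forall m, S m -> branching m -> 0 < dist p m -> dist p a <= dist p m) ->
  exists2 g, G g & g p = p /\ g a = c.
Proof.
move=> Sp bp Sa Sc a0 ac far.
have pa : p <> a by move=> e; rewrite e distxx in a0.
have pc : p <> c by move=> e; rewrite ac e distxx in a0.
have [y [Ey dy]] := next_exists pa; have [z [Ez dz]] := next_exists pc.
have Sy : S y by apply: (convS Sp Sa); rewrite /between dy (dist_adjacent Ey).
have Sz : S z by apply: (convS Sp Sc); rewrite /between dz (dist_adjacent Ez).
have [g Gg [gp gy]] := local_transitivity Sp bp Sy Sz Ey Ez.
exists g => //; split=> //; apply: contrapT => ne.
have dga : dist p (g a) = dist p a by rewrite -{1}gp (dist_aut (autG Gg)).
have hga : halftree p z (g a) by rewrite -{1}gp -gy (halftree_aut (autG Gg)).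
have [m [b1 b2 b3]] := median p c (g a).
have mc : m <> c.
  by move=> e; subst m; apply: ne; apply/esym/dist_eq0; move: b1;
    rewrite /between dga ac; clear; lia.
have ma : m <> g a.
  move=> e; subst m; apply: ne; apply: dist_eq0; move: b2; rewrite /between dga ac;
    clear; lia.
have mp : m <> p.
  move=> e; subst m; apply: (@halftree_opp _ p z).
  by apply: (halftree_convex Ez dz hga).
have [Sm bm] := branching_median Sp Sc (invS Gg Sa) b2 b3 b1 mp mc ma.
have dpm : 0 < dist p m by rewrite lt0n; apply/eqP => /dist_eq0 /esym.
have := far m Sm bm dpm; apply/negP;
  rewrite -ltnNge ac b2 -{1}[dist p m]addn0 ltn_add2l.
by rewrite lt0n; apply/eqP => /dist_eq0.
Qed.

(** [k] is the least positive distance between branching vertices. By [stabilizer_turn], if one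
    vertex of [S] at distance [k] from a branching [p] branches, they all do. This property [good]
    passes from [p] to the branching vertices at distance [k], so an induction in steps of [k]
    determines all of them. *)
Lemma branching_spacing : exists k, [/\ 0 < k,
  exists p1 q1, [/\ S p1, S q1, branching p1 & dist p1 q1 = k]
  & forall p x, S p -> branching p -> S x -> branching x <-> k %| dist p x].
Proof.
have ex : exists n, `[< exists p q, [/\ S p, S q, branching p, branching q
    & dist p q = n /\ 0 < n] >].
  have [p Sp bp] := branching_exists.
  have [g Gg gp] : exists2 g, G g & g p <> p.
    apply: contrapT => none; apply: (nofix Sp) => g Gg; apply: contrapT => gp.
    by apply: none; exists g.
  exists (dist p (g p)); apply/asboolP; exists p, (g p); split=> //.
  - exact: invS.
  - exact: branching_aut.
  - by split=> //; rewrite lt0n; apply/eqP => /dist_eq0 /esym.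
case: (ex_minnP ex) => k /asboolP[p1 [q1 [Sp1 Sq1 bp1 bq1 [dk k0]]]] min0.
have min p q : S p -> S q -> branching p -> branching q -> 0 < dist p q ->
  k <= dist p q.
  by move=> Sp Sq bp bq pq; apply: min0; apply/asboolP; exists p, q.
pose good p := forall x, S x -> dist p x = k -> branching x.
have goodI p q : S p -> S q -> branching p -> branching q -> dist p q = k -> good p.
  move=> Sp Sq bp bq pq x Sx px.
  have [|||g Gg [_ <-]] := @stabilizer_turn p q x Sp bp Sq Sx; rewrite ?pq ?px //.
    by move=> m Sm bm pm; apply: min.
  exact: branching_aut.
have main n : forall p x, S p -> branching p -> good p -> S x -> dist p x = n ->
    (branching x <-> k %| n) /\ (branching x -> good x).
  elim/ltn_ind: n => n IH p x Sp bp gp Sx px.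
  have [lt|le] := ltnP n k.
    have [n0|n0] := posnP n.
      by rewrite n0 in px *; rewrite -(dist_eq0 px).
    have nbx : ~ branching x by move=> bx; have := min p x Sp Sx bp bx; rewrite px; lia.
    by split=> [|/nbx //]; split=> [/nbx //|/dvdn_leq]; lia.
  have [q bq dq] : exists2 q, between p q x &
    dist p q = k by apply: between_exists; rewrite px.
  have Sq : S q := convS Sp Sx bq.
  have brq : branching q by apply: gp.
  have gq : good q by apply: (goodI q p) => //; rewrite distC.
  have dqx : dist q x = n - k by move: bq; rewrite /between px dq; lia.
  have [|h1 h2] := IH (n - k) _ q x Sq brq gq Sx dqx; first by lia.
  by split=> //; rewrite h1 -[in X in _ <-> X](subnK le) dvdn_addl.
have good1 := goodI p1 q1 Sp1 Sq1 bp1 bq1 dk.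
exists k; split=> //; first by exists p1, q1.
move=> p x Sp bp Sx; have [_ gp] := main _ p1 p Sp1 bp1 good1 Sp erefl.
by have [] := main _ p x Sp bp (gp bp) Sx erefl.
Qed.

(** * Coloring the minimal subtree *)

Section Uniform.
Variables (k : nat) (p0 p1 : V).
Hypothesis k0 : 0 < k.
Hypotheses (Sp0 : S p0) (Sp1 : S p1) (bp0 : branching p0) (d01 : dist p0 p1 = k).
Hypothesis spacing :
  forall p x, S p -> branching p -> S x -> branching x <-> k %| dist p x.

Lemma stabilizer_turn_spacing p a c : S p -> branching p -> S a -> S c ->
  dist p a = k -> dist p c = k -> exists2 g, G g & g p = p /\ g a = c.
Proof.
move=> Sp bp Sa Sc pa pc; apply: stabilizer_turn => //;
  rewrite ?pa ?pc // => m Sm bm pm.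
by apply: dvdn_leq => //; apply/spacing.
Qed.

(** Turning around the branching vertex at distance [k] on the way to [x] moves [p] to the vertex at
    distance [2 * k]; then iterate. *)
Lemma even_spacing p x : S p -> branching p -> S x -> 2 * k %| dist p x ->
  exists2 g, G g & g p = x.
Proof.
move=> + + Sx; have [n e] : exists n, dist p x = n by exists (dist p x).
elim/ltn_ind: n p e => n IH p px Sp bp dv.
have [n0|n0] := posnP n.
  by exists 1%g; [exact: (subgroup1 sG)|apply: dist_eq0; rewrite px n0].
have le : 2 * k <= dist p x by apply: dvdn_leq => //; rewrite px.
have [q' bq' dq'] := between_exists le; have Sq' : S q' := convS Sp Sx bq'.
have [q bq dq] : exists2 q, between p q q' & dist p q = k.
  by apply: between_exists; rewrite dq' leq_pmull.
have Sq : S q := convS Sp Sq' bq.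
have brq : branching q by apply/(spacing Sp bp Sq); rewrite dq.
have qq' : dist q q' = k by move: bq; rewrite /between dq dq'; clear; lia.
have qp : dist q p = k by rewrite distC.
have [g Gg [_ gp]] := stabilizer_turn_spacing Sq brq Sp Sq' qp qq'.
have brq' : branching q' by rewrite -gp; apply: branching_aut.
have dq'x : dist q' x = n - 2 * k by move: bq'; rewrite /between dq' px; lia.
have [||h Gh hq'] := IH (n - 2 * k) _ q' dq'x Sq' brq'; first by lia.
  by rewrite dq'x -px dvdn_sub.
by exists (h * g)%g; [exact: (subgroupM sG)|rewrite permM gp].
Qed.

(** A turn around [p0] brings [p1] to the vertex at distance [k] on the way to [x], and
    [even_spacing] covers the rest. *)
Lemma odd_spacing x : S x -> dist p0 x %% (2 * k) = k -> exists2 g, G g & g p1 = x.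
Proof.
move=> Sx e; have le : k <= dist p0 x by rewrite -[k in k <= _]e leq_mod.
have [q bq dq] := between_exists le; have Sq : S q := convS Sp0 Sx bq.
have brq : branching q by apply/(spacing Sp0 bp0 Sq); rewrite dq.
have [g Gg [_ gp]] := stabilizer_turn_spacing Sp0 bp0 Sp1 Sq d01 dq.
have dv : 2 * k %| dist q x.
  have -> : dist q x = dist p0 x - k by move: bq; rewrite /between dq; lia.
  rewrite -[X in _ - X]e {1}(divn_eq (dist p0 x) (2 * k)) addnK dvdn_mull //.
have [h Gh hq] := even_spacing Sq brq Sx dv.
by exists (h * g)%g; [exact: (subgroupM sG)|rewrite permM gp].
Qed.

Local Open Scope classical_set_scope.
Local Open Scope card_scope.

Definition neighbors x : set V := [set y | S y /\ E x y].

Lemma neighbors_aut g x : G g -> neighbors (g x) #= neighbors x.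
Proof.
move=> Gg; suff -> : neighbors (g x) = g @` neighbors x.
  by apply: inj_card_eq => u v _ _; apply: perm_inj.
apply/seteqP; split=> [y [Sy Ey]|_ [y [Sy Ey] <-]]; last first.
  by split; [exact: invS|rewrite (autG Gg)].
exists (g^-1 y)%g; last exact: permKV.
split; first by apply: invS => //; exact: (subgroupV sG).
by rewrite -(autG Gg) permKV.
Qed.

Lemma neighbors_ge3 x : branching x -> `I_3 #<= [set: neighbors x].
Proof.
move=> [y1 [y2 [y3 [[S1 S2 S3] [E1 E2 E3] [n12 n13 n23]]]]].
pose h n := if n is 0 then y1 else if n is 1 then y2 else y3.
rewrite (card_le_eqr (card_setT _)).
have hI : h @` `I_3 #= `I_3.
  apply: inj_card_eq => i j /set_mem /= + /set_mem /=.
  by case: i => [|[|[|//]]]; case: j => [|[|[|//]]] //= _ _ e; exfalso; congruence.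
rewrite -(card_le_eql hI); apply: subset_card_le => _ [[|[|[|?]]] //= _ <-]; by split.
Qed.

(** [iota] serves both conclusions of the theorem: the inclusion of the subtype of an invariant
    subtree, and the identity when [S] is everything. *)
Lemma uniform_of_spacing (W : Type) (EW : rel W) (iota : W -> V) :
  injective iota -> (forall x y, EW x y = E (iota x) (iota y)) ->
  (forall z, S z <-> exists w, iota w = z) -> is_tree EW ->
  is_uniform_subdivision_of_biregular EW.
Proof.
move=> inj_iota EWE imS treeW.
have Siota w : S (iota w) by apply/imS; exists w.
have [w0 iw0] : exists w, iota w = p0 by apply/imS.
have bp1 : branching p1 by apply/(spacing Sp0 bp0 Sp1); rewrite d01.
exists (neighbors p0), (neighbors p1), k; split;
  [exact: neighbors_ge3| exact: neighbors_ge3|].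
(* Color 0 occurs at distances from [p0] divisible by [2 * k], within the orbit of [p0], and color
   [k] at their odd counterparts, within the orbit of [p1]; this makes the degrees constant. *)
split=> //; pose c w := zigzag k (dist p0 (iota w)).
have cS x y : EW x y -> c y = (c x).+1 \/ c x = (c y).+1.
  rewrite EWE /c => Exy; rewrite !(distC p0).
  have [->|->] := adjacent_dist p0 Exy.
    by case: (zigzagS k0 (dist (iota y) p0)); [right|left].
  by case: (zigzagS k0 (dist (iota x) p0)); [left|right].
have card_nb w j : (forall y, EW w y -> c y = j) ->
    [set y | EW w y /\ c y = j] #= neighbors (iota w).
  move=> cj; suff <- : iota @` [set y | EW w y /\ c y = j] = neighbors (iota w).
    by apply/card_esym/inj_card_eq => u v _ _; apply: inj_iota.
  apply/seteqP; split=> [_ [y [Ey _] <-]|z [/imS[y <-] Ez]].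
    by split=> //; rewrite -EWE.
  by exists y => //; rewrite /= EWE; split=> //; apply: cj; rewrite EWE.
exists c; split=> //.
- by move=> x; apply: zigzag_le.
- move=> x cx; have [g Gg gx] := even_spacing Sp0 bp0 (Siota x) (zigzag0 k0 cx).
  apply: card_eq_trans (card_eq_trans _ (card_setT_sym _)).
    by apply: card_nb => y /cS []; rewrite cx.
  by rewrite -gx; apply: neighbors_aut.
- move=> x cx; have [g Gg gx] := odd_spacing (Siota x) (zigzag_max k0 cx).
  apply: card_eq_trans (card_eq_trans _ (card_setT_sym _)).
    apply: card_nb => y /cS []; rewrite cx => e; last by rewrite e.
    by have := zigzag_le k (dist p0 (iota y)); rewrite -/(c y) e ltnn.
  by rewrite -gx; apply: neighbors_aut.
(* An intermediate color means that [k] does not divide the distance to [p0]. So [x] does not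
   branch: its only neighbors in [S] are [z0], nearer to [p0], and [z1], farther away. *)
move=> x cx; have Sx := Siota x.
have nbx : ~ branching (iota x).
  move=> /(spacing Sp0 bp0 Sx) /(zigzag_dvd k0); rewrite -/(c x).
  by clear -cx; case=> e; rewrite e ?ltnn ?andbF in cx.
have xp : iota x <> p0 by move=> e; apply: nbx; rewrite e.
have [z0 [Ez0 dz0]] := next_exists xp.
have Sz0 : S z0 by apply: (convS Sx Sp0); rewrite /between dz0 (dist_adjacent Ez0).
have [z1 [Sz1 Ez1 z01]] := two_neighbors Sx Sz0 Ez0.
have dz1 : dist z1 p0 = (dist (iota x) p0).+1.
  by have := halftree_neighbor Ez1 Ez0 (nesym z01); have [e|//] := adjacent_dist p0 Ez1;
    case: z01; apply: (next_unique Ez0 Ez1 dz0 e).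
have [y0 ey0] : exists w, iota w = z0 by apply/imS.
have [y1 ey1] : exists w, iota w = z1 by apply/imS.
have two y : EW x y -> y = y0 \/ y = y1.
  rewrite EWE => Ey; have [/eqP e|/eqP n0] := eqVneq (iota y) z0.
    by left; apply: inj_iota; rewrite ey0; apply/eqP.
  have [/eqP e|/eqP n1] := eqVneq (iota y) z1.
    by right; apply: inj_iota; rewrite ey1; apply/eqP.
  case: nbx; exists z0, z1, (iota y); split=> //; by split=> // e;
    [apply: n0|apply: n1].
have Exy0 : EW x y0 by rewrite EWE ey0.
have Exy1 : EW x y1 by rewrite EWE ey1.
have cc : (c y0 = (c x).-1 /\ c y1 = (c x).+1) \/
          (c y0 = (c x).+1 /\ c y1 = (c x).-1).
  move: cx; rewrite /c ey0 ey1 !(distC p0) dz1 dz0 => cx.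
  exact: zigzag_turn.
have uniq_of y y' j : EW x y -> c y = j -> (forall u, EW x u -> u = y \/ u = y') ->
    c y' <> j -> exists! u, EW x u /\ c u = j.
  move=> Ey cy yy' ne; exists y; split=> // u [/yy' [//|->] cu].
  by case: ne.
have sw u : EW x u -> u = y1 \/ u = y0 by move/two => [] ->; [right|left].
have c0 : 0 < c x by case/andP: cx.
case: cc => -[c0' c1']; split.
- by apply: (uniq_of y0 y1) => //; rewrite c1'; clear -c0; lia.
- by apply: (uniq_of y1 y0) => //; rewrite c0'; clear -c0; lia.
- by apply: (uniq_of y1 y0) => //; rewrite c0'; clear -c0; lia.
- by apply: (uniq_of y0 y1) => //; rewrite c1'; clear -c0; lia.
Qed.

End Uniform.

End MinimalAction.

(** * Ends and minimal invariant subtrees *)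

Section Ends.
Local Open Scope classical_set_scope.
Variable T : tree.
Local Notation V := (vertex T).
Local Notation E := (@adjacent T).
Implicit Types r : nat -> V.

(** If the distance to [r i] decreased at some step, the two ray neighbors of that vertex would both
    be the next vertex towards [r i], against injectivity. *)
Lemma ray_dist r i n : is_ray E r -> dist (r i) (r (i + n)) = n.
Proof.
move=> [inj_r Er]; have [m le] : exists m, n <= m by exists n.
elim: m n le => [|m IH] n le.
  by move: le; rewrite leqn0 => /eqP ->; rewrite addn0 distxx.
case: n le => [|[|n]] le; first by rewrite addn0 distxx.
  by rewrite addn1 dist_adjacent.
have h1 := IH n (ltnW le); have h2 := IH n.+1 le.
have E1 : E (r (i + n.+1)) (r (i + n)) by rewrite addnS adjacent_sym.
have E2 : E (r (i + n.+1)) (r (i + n.+2)) by rewrite !addnS.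
have [e|e] := adjacent_dist (r i) E2; last by rewrite distC e distC h2.
suff /inj_r : r (i + n) = r (i + n.+2) by lia.
by apply: (next_unique E1 E2 _ e); rewrite /halftree /= distC h2 distC h1.
Qed.

(** Equivalence of rays expressed by a shift of indices, which composes more easily than the
    intersection of ranges in [ray_equiv]. *)
Definition same_tail r r' := exists a c, forall i, r (a + i) = r' (c + i).

Lemma same_tail_trans r1 r2 r3 :
  same_tail r1 r2 -> same_tail r2 r3 -> same_tail r1 r3.
Proof.
move=> [a [c e]] [a' [c' e']]; exists (a + a'), (c' + c) => i.
by rewrite -addnA e addnCA e' addnCA addnA [c' + c]addnC -addnA addnCA addnA.
Qed.

(** Between two meeting points both rays follow the same geodesic, so they agree there index by
    index. *)
Lemma tail_of_meeting r r' a c : is_ray E r -> is_ray E r' -> r a = r' c ->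
  (forall n, exists i j, n <= i /\ r i = r' j) ->
  forall i, r (a + i) = r' (c + i).
Proof.
(* A meeting this far out on [r] cannot precede [r' c] on [r']: its distance to [r' c] exceeds
   [c]. *)
move=> ray_r ray_r' e unb i; have [k [j [le ek]]] := unb (a + i + c + 1).
have dk : dist (r a) (r k) = k - a by rewrite -{1}(subnKC (_ :
  a <= k)) ?ray_dist //; lia.
have [jc|cj] := ltnP j c.
  have : dist (r' j) (r' (j + (c - j))) = c - j by apply: ray_dist.
  by rewrite subnKC ?(ltnW jc) // -ek -e distC dk; lia.
have dj : dist (r' c) (r' (c + (j - c))) = j - c by apply: ray_dist.
rewrite subnKC // -ek -e dk in dj.
apply: (@between_unique _ (r a) _ _ (r k)); rewrite /between.
- rewrite dk ray_dist // -[in r k](subnKC (_ : a + i <= k)) ?ray_dist //; lia.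
- rewrite dk {1}e ek ray_dist // -[in r' j](subnKC (_ : c + i <= j)) ?ray_dist //; lia.
- by rewrite {2}e !ray_dist.
Qed.

Lemma ray_equiv_tail r r' : is_ray E r -> is_ray E r' ->
  ray_equiv E r r' <-> same_tail r r'.
Proof.
move=> ray_r ray_r'; split=> [[r2 ray2 e]|[a0 [c0 e]]].
  have meet n : exists i j, r2 n = r i /\ r i = r' j.
    have [[i _ ei] [j _ ej]] : (range r `&` range r') (r2 n) by rewrite -e; exists n.
    by exists i, j; rewrite ei ej.
  have [i0 [j0 [_ e0]]] := meet 0.
  exists i0, j0; apply: tail_of_meeting => // n.
  pose D := dist (r 0) (r2 0); have [i [j [ei ej]]] := meet (n + D).
  exists i, j; split=> //.
  have := ray_dist 0 i ray_r; rewrite add0n => <-; rewrite -ei.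
  have := ray_dist 0 (n + D) ray2; rewrite add0n.
  have := dist_triangle (r2 0) (r 0) (r2 (n + D)); rewrite (distC (r2 0) (r 0)) -/D.
  by move: (dist _ _) (dist _ _) => u v; clear; lia.
(* The common part of the two rays is the tail of [r] from its first vertex lying on [r']. *)
have ex : exists a, `[< exists c, r a = r' c >].
  by exists (a0 + 0); apply/asboolP; exists (c0 + 0).
case: (ex_minnP ex) => a /asboolP[c ac] min.
have unb n : exists i j, n <= i /\ r i = r' j.
  by exists (a0 + n), (c0 + n); rewrite e; split=> //; rewrite leq_addl.
have tl := tail_of_meeting ray_r ray_r' ac unb.
exists (fun i => r (a + i)).
  by case: ray_r => inj_r Er; split=> [i j /inj_r /addnI //|i]; rewrite addnS.
apply/seteqP; split=> [_ [i _ <-]|_ [[i _ <-] [j _ ej]]].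
  by split; [exists (a + i)|exists (c + i)].
have le : a <= i by apply: min; apply/asboolP; exists j.
by exists (i - a) => //; rewrite subnKC.
Qed.

Lemma ray_aut (g : permutation V) r : automorphisms E g ->
  is_ray E r -> is_ray E (g \o r).
Proof.
move=> ag [ir Er]; split; first exact: inj_comp (@perm_inj _ g) ir.
by move=> i /=; rewrite ag.
Qed.

Variable G : set (permutation V).
Hypothesis sG : subgroup_set G.
Hypothesis autG : forall g, G g -> automorphisms E g.

Lemma fixes_end_of_tail r : is_ray E r ->
  (forall g, G g -> same_tail r (g \o r)) ->
  fixes_end G [set r' | is_ray E r' /\ ray_equiv E r r'].
Proof.
move=> ray_r tl g Gg.
have stable h r1 : G h -> is_ray E r1 /\ ray_equiv E r r1 ->
    is_ray E (h \o r1) /\ ray_equiv E r (h \o r1).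
  move=> Gh [ray1 /(ray_equiv_tail ray_r ray1) [a [c e]]].
  have ray_h := ray_aut (autG Gh) ray1; split=> //; apply/ray_equiv_tail => //.
  apply: same_tail_trans (tl h Gh) _; exists a, c => i /=; by rewrite e.
apply/seteqP; split=> [_ [r1 r1P <-]|r1 r1P]; first exact: stable.
exists (g^-1%g \o r1); first exact: stable (subgroupV sG Gg) r1P.
by apply/funext => i /=; rewrite -[perm_inv g _]/((g^-1)%g (r1 i)) permKV.
Qed.

Definition invariant_convex (S : set V) :=
  [/\ convex S, S !=set0 & forall g x, G g -> S x -> S (g x)].

(** * Chains of invariant convex sets with empty intersection *)

Section Chain.
Variable C : set (set V).
Hypothesis C_neq0 : C !=set0.
Hypothesis C_inv : forall S, C S -> invariant_convex S.
Hypothesis C_total : total_on C subset.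
Hypothesis C_empty : forall x, exists2 S, C S & ~ S x.

Definition gate (S : set V) (x y : V) := S y /\ forall z, S z -> between x y z.

Lemma chain_gate S x : C S -> exists y, gate S x y.
Proof. by move=> /C_inv[cS S0 _]; have [y Sy gy] := gate_exists x cS S0; exists y. Qed.

(** If the distances from [x] to the gates were bounded, choose a gate as far as possible. A member
    missing it is contained in the member it belongs to, so its gate is strictly farther. *)
Lemma chain_far x n : exists2 S, C S & forall z, S z -> n < dist x z.
Proof.
apply: contrapT => none.
have near S y : C S -> gate S x y -> dist x y <= n.
  move=> CS [Sy gy]; rewrite leqNgt; apply/negP => lt; apply: none; exists S => // z Sz.
  by rewrite (gy z Sz) ltn_addr.
have ex : exists m, `[< exists S y, [/\ C S, gate S x y & dist x y = m] >].
  have [S CS] := C_neq0; have [y gy] := chain_gate x CS.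
  by exists (dist x y); apply/asboolP; exists S, y.
have bnd m : `[< exists S y, [/\ C S, gate S x y & dist x y = m] >] -> m <= n.
  by move=> /asboolP[S [y [CS gy <-]]]; apply: near gy.
case: (ex_maxnP ex bnd) => m /asboolP[S [y [CS [Sy gy] dy]]] max.
have [S' CS' nS'y] := C_empty y; have [y' [S'y' gy']] := chain_gate x CS'.
have [SS'|S'S] := C_total CS CS'; first exact: nS'y (SS' _ Sy).
have le : dist x y' <= dist x y by rewrite dy; apply: max; apply/asboolP; exists S', y'.
suff e : y = y' by apply: nS'y; rewrite e.
by apply: dist_eq0; move: (gy _ (S'S _ S'y')); rewrite /between; lia.
Qed.

Variable x0 : V.

(** The geodesics from [x0] to the gates of smaller and smaller members extend one another, so the
    vertex at distance [n] does not depend on the member. *)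
Definition ray_point n p := exists S (y : V),
  [/\ C S, gate S x0 y & n <= dist x0 y /\ between x0 p y /\ dist x0 p = n].

Lemma between_trans (a b c e : V) : between a b c -> between a c e -> between a b e.
Proof.
by rewrite /between => h1 h2; have := dist_triangle a b e; have :=
  dist_triangle b c e; lia.
Qed.

Lemma ray_point_unique n p p' : ray_point n p -> ray_point n p' -> p = p'.
Proof.
move=> [S [y [CS gy [le [bp dp]]]]] [S' [y' [CS' gy' [le' [bp' dp']]]]].
have [SS'|S'S] := C_total CS CS'.
  apply: (between_unique bp); last by rewrite dp.
  by apply: between_trans bp' _; apply: gy'.2; apply: SS'; case: gy.
apply: (between_unique _ bp'); last by rewrite dp.
by apply: between_trans bp _; apply: gy.2; apply: S'S; case: gy'.
Qed.

Lemma ray_point_exists n : exists p, ray_point n p.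
Proof.
have [S CS far] := chain_far x0 n; have [y gy] := chain_gate x0 CS.
have le : n <= dist x0 y by apply: ltnW; apply: far; case: gy.
by have [p bp dp] := between_exists le; exists p, S, y.
Qed.

Definition chain_ray n := sval (cid (ray_point_exists n)).

Lemma chain_rayP n : ray_point n (chain_ray n).
Proof. by rewrite /chain_ray; case: cid. Qed.

Lemma chain_ray_is_ray : is_ray E chain_ray.
Proof.
split=> [i j e|i].
  have [S [y [_ _ [_ [_ <-]]]]] := chain_rayP i.
  by have [S' [y' [_ _ [_ [_ <-]]]]] := chain_rayP j; rewrite e.
have [S [y [CS gy [le [bp dp]]]]] := chain_rayP i.+1; move: dp bp.
move: (chain_ray i.+1) => q dq bq.
have [p bp dp] : exists2 p, between x0 p q &
  dist x0 p = i by apply: between_exists; rewrite dq.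
have -> : chain_ray i = p.
  apply: ray_point_unique (chain_rayP i) _; exists S, y; split=> //.
  by split; [exact: ltnW|split=> //; exact: between_trans bp bq].
by apply: adjacent_of_dist1; move: bp; rewrite /between dq dp; lia.
Qed.

(** [g] fixes the gate [y] of every member far enough. Otherwise the geodesics from [x0] to [y],
    from [y] to [g y] and from [g y] to [g x0] would concatenate, and [g x0] would be too far from
    [x0]. *)
Lemma chain_ray_tail g : G g -> same_tail chain_ray (g \o chain_ray).
Proof.
move=> Gg; have ag := autG Gg.
have unb n : exists i, n <= i /\ chain_ray i = g (chain_ray i).
  have [S CS far] := chain_far x0 (n + dist x0 (g x0)).
  have [y [Sy gy]] := chain_gate x0 CS; have [_ _ invS] := C_inv CS.
  have lt := far y Sy; exists (dist x0 y); split; first by lia.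
  have -> : chain_ray (dist x0 y) = y.
    apply: ray_point_unique (chain_rayP _) _; exists S, y; split=> //.
    by split=> //; split=> //; rewrite /between distxx addn0.
  have b1 : between x0 y (g y) by apply: gy; apply: invS.
  have b2 : between y (g y) (g x0).
    apply: betweenC; rewrite -[X in between _ _ X](permKV g y) between_aut //;
      apply: gy; apply: invS => //.
    exact: subgroupV sG Gg.
  apply: contrapT => ne; have := between_local b1 b2 ne; rewrite /between; lia.
have [i0 [_ e0]] := unb 0.
exists i0, i0; apply: tail_of_meeting => //; first exact: chain_ray_is_ray.
  exact: ray_aut ag chain_ray_is_ray.
by move=> n; have [i [le e]] := unb n; exists i, i.
Qed.

Lemma chain_fixes_end : exists b, is_end E b /\ fixes_end G b.
Proof.
exists [set r' | is_ray E r' /\ ray_equiv E chain_ray r']; split.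
  by exists chain_ray; first exact: chain_ray_is_ray.
by apply: fixes_end_of_tail; [exact: chain_ray_is_ray|exact: chain_ray_tail].
Qed.

End Chain.

(** [Zorn_bigcup] provides maximal sets from unions of chains, so it is applied to complements. The
    empty chain is treated apart: there the complement of the union is the whole vertex set. *)
Lemma minimal_invariant_convex (x0 : V) :
  ~ (exists b, is_end E b /\ fixes_end G b) ->
  exists2 S, invariant_convex S &
    forall S', invariant_convex S' -> S' `<=` S -> S `<=` S'.
Proof.
move=> noend; pose P (X : set V) := invariant_convex (~` X).
have [F FP totF|S [PS max]] := @Zorn_bigcup V P.
  have [[X0 FX0]|F0] := pselect (F !=set0); last first.
    split=> [x m z _ _ _|| g x _ _]; last 1 first.
    - by move=> [X FX]; case: F0; exists X.
    - by move=> [X FX]; case: F0; exists X.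
    - by exists x0 => -[X FX]; case: F0; exists X.
  split=> [x m z nx nz b [X FX Xm]||g x Gg nx [X FX Xgx]].
  - have [cX _ _] := FP _ FX; apply: (cX x m z _ _ b) => // Xx.
      by apply: nx; exists X.
    by apply: nz; exists X.
  - apply: contrapT => empty; apply: noend.
    pose C : set (set V) := [set S | F (~` S)].
    have CE S : C S -> exists2 X, F X & S = ~` X.
      by move=> CS; exists (~` S) => //; rewrite setCK.
    apply: (@chain_fixes_end C).
    + by exists (~` X0); rewrite /C /= setCK.
    + by move=> S /CE[X FX ->]; apply: FP.
    + move=> S S' /CE[X FX ->] /CE[X' FX' ->].
      by have [h|h] := totF _ _ FX FX'; [right|left]; apply: subsetC.
    + move=> x; apply: contrapT => none; apply: empty; exists x => -[X FX Xx].
      apply: none; exists (~` X); first by rewrite /C /= setCK.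
      by move=> /(_ Xx).
    + exact: x0.
  - have [_ _ iX] := FP _ FX; apply: (iX g x Gg) Xgx => Xx.
    by apply: nx; exists X.
exists (~` S) => // S' iS' S'S x nSx; apply: contrapT => nS'x.
apply: (max (~` S')); last by rewrite /P setCK.
split; first by move=> z Sz S'z; exact: (S'S z S'z Sz).
by move=> /(_ x nS'x).
Qed.

End Ends.

(** * Bounded simplicity *)

Section ColoredTree.
Variable T : tree.
Local Notation V := (vertex T).
Local Notation E := (@adjacent T).
Variables (I : Type) (f : V -> I).
Local Notation A := (color_automorphisms E f).
Local Notation G := (color_automorphisms_plus E f).
Implicit Types g h : permutation V.

Lemma color_automorphisms_subgroup : subgroup_set A.
Proof.
apply: subgroup_intro => [|g h [ag fg] [ah fh]]; first by split.
split.
  by move=> x y; rewrite !permM ag -ah !permKV.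
apply/funext => x /=; have := congr1 (fun F => F ((h^-1)%g x)) fh.
rewrite /= -[perm_inv h x]/((h^-1)%g x) permKV => ->.
exact: (congr1 (fun F => F ((h^-1)%g x)) fg).
Qed.

Let sA := color_automorphisms_subgroup.
Let sG : subgroup_set G := generated_is_subgroup _.

Lemma plus_incl g : G g -> A g.
Proof. by apply: generated_min => // h [x [y [_ []]]]. Qed.

Lemma plus_aut g : G g -> automorphisms E g.
Proof. by move=> /plus_incl[]. Qed.

Lemma fix_edge_plus g x y : A g -> E x y -> g x = x -> g y = y -> G g.
Proof. by move=> Ag Exy gx gy; apply: generated_incl; exists x, y. Qed.

(** * Gluing automorphisms along edges *)

Definition locally_colored (phi : V -> V) := forall z z', z = z' \/ E z z' ->
  exists2 g, A g & phi z = g z /\ phi z' = g z'.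

Lemma glue phi psi : cancel phi psi -> cancel psi phi ->
  locally_colored phi -> locally_colored psi ->
  exists2 g, A g & forall z, g z = phi z.
Proof.
move=> K K' lphi lpsi; exists (Permutation K K') => //; split=> [x y /=|].
  apply/idP/idP => Exy.
    have [g Ag [gx gy]] := lpsi _ _ (or_intror Exy).
    by rewrite -(K x) -(K y) gx gy Ag.1.
  by have [g Ag [-> ->]] := lphi _ _ (or_intror Exy); rewrite Ag.1.
apply/funext => x /=; have [g [_ fg] [-> _]] := lphi x x (or_introl erefl).
exact: (congr1 (fun F => F x) fg).
Qed.

Definition glue_fun (w w' : V) (h b : permutation V) z :=
  if `[< halftree w w' z >] then h z else b z.

Lemma glue_fun_local w w' h (b : permutation V) : A h -> A b -> E w w' ->
  h w = b w -> h w' = b w' ->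
  locally_colored (glue_fun w w' h b).
Proof.
move=> Ah Ab Ew hw hw' z z' zz'.
have cross u u' : u = u' \/ E u u' -> halftree w w' u -> ~ halftree w w' u' ->
    u = w' /\ u' = w.
  by move=> [<- //|Eu] hu /(halftreeC Ew) hu'; apply: (halftree_edge Ew Eu).
have zz'C : z' = z \/ E z' z by case: zz' => [->|]; [left|rewrite adjacent_sym; right].
rewrite /glue_fun; case: asboolP => hz; case: asboolP => hz'.
- by exists h.
- by have [-> ->] := cross _ _ zz' hz hz'; exists h.
- by have [-> ->] := cross _ _ zz'C hz' hz; exists h.
- by exists b.
Qed.

Lemma glue_halftree w w' h (b : permutation V) : A h -> A b -> E w w' ->
  h w = b w -> h w' = b w' ->
  exists2 c, A c & (forall z, halftree w w' z -> c z = h z) /\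
                   (forall z, ~ halftree w w' z -> c z = b z).
Proof.
move=> Ah Ab Ew hw hw'.
have Ah' : A h^-1%g by exact: (subgroupV sA).
have Ab' : A b^-1%g by exact: (subgroupV sA).
have K : cancel (glue_fun w w' h b) (glue_fun (h w) (h w') h^-1%g b^-1%g).
  move=> z; rewrite /glue_fun; case: (asboolP (halftree w w' z)) => hz.
    by rewrite halftree_aut ?asboolT ?permK //; case: Ah.
  by rewrite hw hw' halftree_aut ?asboolF ?permK //; case: Ab.
have K' : cancel (glue_fun (h w) (h w') h^-1%g b^-1%g) (glue_fun w w' h b).
  move=> z; rewrite /glue_fun; case: (asboolP (halftree (h w) _ z)) => hz.
    rewrite asboolT ?permKV //; rewrite -(permKV h z) halftree_aut // in hz.
    by case: Ah.
  rewrite asboolF ?permKV //; move=> hz'; apply: hz.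
  by rewrite hw hw' -(permKV b z) halftree_aut //; case: Ab.
have [||c Ac cE] := glue K K'.
- exact: glue_fun_local.
- apply: glue_fun_local => //; first by rewrite Ah.1.
    by rewrite permK hw permK.
  by rewrite permK hw' permK.
exists c => //; split=> z hz; rewrite cE /glue_fun; first by rewrite asboolT.
by rewrite asboolF.
Qed.

(** Nothing is known about [g y], so [g] is used on the halftree of [x], its inverse on that of [y],
    and the identity elsewhere; the result is an involution. *)
Lemma swap_halftrees g p x y : A g -> E p x -> E p y -> x <> y ->
  g p = p -> g x = y ->
  exists2 c, A c & [/\ c p = p, c x = y &
    forall z, ~ halftree p x z -> ~ halftree p y z -> c z = z].
Proof.
move=> Ag Ex Ey xy gp gx.
have autg : automorphisms E g by case: Ag.
have Ag' : A g^-1%g by exact: (subgroupV sA).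
have g'y : (g^-1)%g y = x by rewrite -gx permK.
have g'p : (g^-1)%g p = p by rewrite -{1}gp permK.
have hxy z : halftree p x z -> ~ halftree p y z.
  by move=> h1 h2; apply: xy; apply: next_unique h2.
pose phi z := if `[< halftree p x z >] then g z else
  if `[< halftree p y z >] then (g^-1)%g z else z.
have phix z : halftree p x z -> phi z = g z by move=> h; rewrite /phi asboolT.
have phiy z : halftree p y z -> phi z = (g^-1)%g z.
  move=> h; rewrite /phi asboolF ?asboolT //.
  by move=> h'; apply: hxy h.
have phi0 z : ~ halftree p x z -> ~ halftree p y z -> phi z = z.
  by move=> h h'; rewrite /phi !asboolF.
have imx z : halftree p x z -> halftree p y (g z).
  by rewrite -{2}gp -gx halftree_aut.
have imy z : halftree p y z -> halftree p x ((g^-1)%g z).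
  by rewrite -{1}gp -gx -{1}(permKV g z) halftree_aut.
have K : cancel phi phi.
  move=> z; have [h|h] := pselect (halftree p x z).
    by rewrite (phix z h) phiy ?permK //; apply: imx.
  have [h'|h'] := pselect (halftree p y z).
    by rewrite (phiy z h') phix ?permKV //; apply: imy.
  by rewrite !phi0.
have phip : phi p = p by apply: phi0; apply: halftree_opp.
have near r u u' : E p r -> u = u' \/ E u u' -> halftree p r u ->
    halftree p r u' \/ u' = p.
  move=> Er [<-|Eu] hu; first by left.
  have [|/(halftreeC Er) hu'] := pselect (halftree p r u'); first by left.
  by right; have [] := halftree_edge Er Eu hu hu'.
have locx u u' : u = u' \/ E u u' -> halftree p x u ->
    exists2 a, A a & phi u = a u /\ phi u' = a u'.
  move=> uu' hu; exists g => //; rewrite phix //; split=> //.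
  by have [/phix|->] := near _ _ _ Ex uu' hu; rewrite ?phip ?gp.
have locy u u' : u = u' \/ E u u' -> halftree p y u ->
    exists2 a, A a & phi u = a u /\ phi u' = a u'.
  move=> uu' hu; exists g^-1%g => //; rewrite phiy //; split=> //.
  by have [/phiy|->] := near _ _ _ Ey uu' hu; rewrite ?phip ?g'p.
have loc : locally_colored phi.
  move=> z z' zz'.
  have zz'C : z' = z \/ E z' z by case: zz' => [->|]; [left|rewrite adjacent_sym;
    right].
  have [h1|h1] := pselect (halftree p x z); first exact: locx.
  have [h2|h2] := pselect (halftree p y z); first exact: locy.
  have [h3|h3] := pselect (halftree p x z').
    by have [a Aa [? ?]] := locx _ _ zz'C h3; exists a.
  have [h4|h4] := pselect (halftree p y z').
    by have [a Aa [? ?]] := locy _ _ zz'C h4; exists a.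
  by exists 1%g; [exact: (subgroup1 sA)|rewrite !phi0].
have [c Ac cE] := glue K K loc loc; exists c => //; rewrite !cE phip; split=> //.
  by rewrite phix //; apply: halftree_self.
by move=> z h h'; rewrite cE phi0.
Qed.

(** * Locally transitive actions on the whole tree *)

Local Notation branching := (branching [set: V]%classic).

Hypothesis orbit_meets : forall p q w, E q w ->
  exists2 g, G g & halftree q w (g p).
Hypothesis local_trans : forall b y y', branching b -> E b y -> E b y' ->
  exists2 g, G g & g b = b /\ g y = y'.
Variable k : nat.
Hypothesis k0 : 0 < k.
Hypothesis spacing : forall p x, branching p -> branching x <-> k %| dist p x.
Hypothesis branching_ex : exists p, branching p.
Hypothesis two_neighbors_ex : forall x, exists y z, [/\ E x y, E x z & y <> z].

Lemma branching_avoid x a b : branching x -> exists v, [/\ E x v, v <> a & v <> b].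
Proof.
move=> [y1 [y2 [y3 [_ [E1 E2 E3] [n12 n13 n23]]]]].
have [e1|/eqP ne1] := eqVneq y1 a; have [e1'|/eqP ne1'] := eqVneq y1 b.
- by exists y2; split=> // e; congruence.
- have [e2|/eqP ne2] := eqVneq y2 b; last by exists y2; split=> //; congruence.
  by exists y3; split=> //; congruence.
- have [e2|/eqP ne2] := eqVneq y2 a; last by exists y2; split=> //; congruence.
  by exists y3; split=> //; congruence.
- by exists y1.
Qed.

Lemma branching_of3 x a b c : E x a -> E x b -> E x c ->
  a <> b -> a <> c -> b <> c -> branching x.
Proof. by move=> *; exists a, b, c. Qed.

Lemma plus_branching g x : G g -> branching x -> branching (g x).
Proof.
move=> Gg [y1 [y2 [y3 [_ [E1 E2 E3] [n12 n13 n23]]]]].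
have autg := plus_aut Gg.
by apply: (@branching_of3 _ (g y1) (g y2) (g y3)); rewrite ?autg // => /perm_inj.
Qed.

(** First move [p] across the edge from [q] to [w], then rotate around its image so that [y] points
    back to [q]; the opposite side is then nested beyond the edge. *)
Lemma push_halftree p y q w : branching p -> E p y -> E q w ->
  exists2 u, G u & forall z, halftree (u y) (u p) z -> halftree q w z.
Proof.
move=> bp Ey Eq; have [u0 Gu0 hu] := orbit_meets p Eq.
have [|y' [Ey' dy']] := @next_exists _ (u0 p) q.
  by move=> e; move: hu; rewrite e; apply: halftree_opp.
have Ey0 : E (u0 p) (u0 y) by rewrite (plus_aut Gu0).
have [g Gg [gp gy]] := local_trans (plus_branching Gu0 bp) Ey0 Ey'.
exists (g * u0)%g; first exact: (subgroupM sG).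
move=> z; rewrite !permM gp gy; exact: halftree_nest Eq Ey' hu dy'.
Qed.

(** Induction on the distance to [p]. Once the predecessor of [x] is sent to [u'], the images [b x]
    and [x'] are neighbors of [u'], which branches because of a third one towards [e]. Swapping
    their halftrees corrects [b] without touching [p] or the halftree of [e]. *)
Lemma extend_halftree n e p x x' : E p e -> halftree e p x -> halftree e p x' ->
  dist p x = n -> dist p x' = n ->
  exists2 b, A b & [/\ b p = p, b x = x' & forall z, halftree p e z -> b z = z].
Proof.
move=> Epe; have Eep : E e p by rewrite adjacent_sym.
elim: n x x' => [|n IH] x x' hx hx' px px'.
  exists 1%g; first exact: (subgroup1 sA).
  by rewrite -(dist_eq0 px) -(dist_eq0 px').
have pred v : halftree e p v -> dist p v = n.+1 ->
    exists u, [/\ E v u, halftree e p u & dist p u = n].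
  move=> hv pv; have [|u [Eu du]] := @next_exists _ v p.
    by move=> ev; rewrite ev distxx in pv.
  exists u; split=> //; last by move: du; rewrite (distC v) pv (distC u) => -[].
  move: hv du (dist_triangle e u v) (adjacent_dist u Eep);
    rewrite /halftree /= (distC u v) (dist_adjacent Eu).
  rewrite (distC v p) (distC u p); clear; lia.
have [u [Eu hu pu]] := pred x hx px; have [u' [Eu' hu' pu']] := pred x' hx' px'.
have [b Ab [bp bu bz]] := IH u u' hu hu' pu pu'.
have [bx|/eqP bx] := eqVneq (b x) x'; first by exists b.
have autb : automorphisms E b by case: Ab.
have be : b e = e by apply: bz; apply: halftree_self.
have hbx : halftree e p (b x) by rewrite -{1}be -{1}bp halftree_aut.
have pbx : dist p (b x) = n.+1 by rewrite -{1}bp dist_aut.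
have E1 : E u' (b x) by rewrite -bu autb adjacent_sym.
have E2 : E u' x' by rewrite adjacent_sym.
have away v : E u' v -> halftree e p v -> dist p v = n.+1 ->
    forall z, z = p \/ halftree p e z -> ~ halftree u' v z.
  move=> Ev hv pv z hz; rewrite /halftree /= => h.
  have [h1 h2] : dist z v = dist z p + n.+1 /\ dist z u' = dist z p + n.
    case: hz => [->|hz]; first by rewrite distxx.
    rewrite (halftree_cross Epe hz hv) (halftree_cross Epe hz hu') pv pu'.
    by move: hz; rewrite /halftree /= (distC z p) (distC z e) => ->; clear; lia.
  by move: h; rewrite (distC u') (distC v) h1 h2; clear; lia.
have [t [Et dt]] : exists t, E u' t /\ dist u' e = (dist t e).+1.
  by apply: next_exists => e'; rewrite e' in hu'; exact: (halftree_opp hu').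
have far v : halftree e p v -> dist p v = n.+1 -> t <> v.
  move=> hv pv etv; subst v; move: dt hv hu'; rewrite /halftree /= (distC u') (distC t).
  by rewrite pv pu'; clear; lia.
have bru : branching u'.
  by apply: (branching_of3 Et E1 E2) => //; apply: far.
have [g Gg [gu gbx]] := local_trans bru E1 E2.
have [c Ac [cu cbx cz]] := swap_halftrees (plus_incl Gg) E1 E2 bx gu gbx.
have cfix z : z = p \/ halftree p e z -> c z = z.
  by move=> hz; apply: cz; apply: away hz.
exists (c * b)%g; first exact: (subgroupM sA).
rewrite !permM bp cbx; split=> //; first by apply: cfix; left.
by move=> z hz; rewrite permM bz //; apply: cfix; right.
Qed.

Lemma spacing_median x y z m : branching x -> branching y -> branching z ->
  between x m y -> between y m z -> between x m z -> k %| dist y m.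
Proof.
move=> bx by_ bz b1 b2 b3; apply/spacing => //.
have [->//|/eqP mx] := eqVneq m x; have [->//|/eqP my] := eqVneq m y.
have [->//|/eqP mz] := eqVneq m z.
by have [] := @branching_median _ [set: V]%classic _ x y z m.
Qed.

(** Medians of branching vertices are at distances divisible by [k] from them, so their distances
    are additive modulo [2 * k]. It remains to find a branching vertex fixed by a generator. *)
Lemma even_plus g x : G g -> branching x -> 2 * k %| dist x (g x).
Proof.
pose P : set (permutation V) := fun g => G g /\
  forall x, branching x -> 2 * k %| dist x (g x).
suff : (G `<=` P)%classic by move=> GP /GP [_ +]; apply.
move=> {}g; apply: generated_min => [|{x}{}g gg].
  apply: subgroup_intro => [|g1 g2 [G1 P1] [G2 P2]].
    by split=> [|z _]; [exact: (subgroup1 sG)|rewrite perm1 distxx].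
  have G2' : G g2^-1%g by exact: (subgroupV sG).
  split=> [|z bz]; first exact: (subgroupM sG).
  rewrite permM; set u := (g2^-1)%g z.
  have bu : branching u by apply: plus_branching.
  have h1 : 2 * k %| dist z u by rewrite distC -{1}(permKV g2 z); exact: P2.
  have h2 := P1 u bu; have [m [b1 b2 b3]] := median z u (g1 u).
  have dm := spacing_median bz bu (plus_branching G1 bu) b2 b3 b1.
  have : 2 * k %| dist z (g1 u) + 2 * dist u m.
    have -> : dist z (g1 u) + 2 * dist u m = dist z u + dist u (g1 u).
      by move: b1 b2 b3; rewrite /between (distC m u); clear; lia.
    exact: dvdn_add.
  by rewrite dvdn_addl // dvdn_pmul2l.
have Gg : G g by apply: generated_incl.
split=> // x bx; case: gg => u [v [Euv [[autg _] gu gv]]].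
suff [w bw gw] : exists2 w, branching w & g w = w.
  have dgx : dist w (g x) = dist x w by rewrite -{1}gw dist_aut // distC.
  have [m [b1 b2 b3]] := median x w (g x).
  have dm := spacing_median bx bw (plus_branching Gg bx) b2 b3 b1.
  have : 2 * k %| dist x (g x) + 2 * dist w m.
    have -> : dist x (g x) + 2 * dist w m = 2 * dist x w.
      by move: b1 b2 b3; rewrite /between dgx (distC m w); clear; lia.
    by rewrite dvdn_pmul2l //; apply/(spacing _ bx).
  by rewrite dvdn_addl // dvdn_pmul2l.
(* Walk from the fixed edge towards a branching vertex: as long as the current vertex does not
   branch, its next neighbor is fixed too. *)
have [p bp] := branching_ex; have [h Gh] := orbit_meets p Euv.
have := plus_branching Gh bp; move: (h p) => w bw hw.
have [n e] : exists n, dist v w = n by exists (dist v w).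
elim: n u v Euv gu gv hw e => [|n IH] u v Euv gu gv hw e.
  by exists v => //; rewrite (dist_eq0 e).
have [bv|nbv] := pselect (branching v); first by exists v.
have [|v2 [Ev dv]] := @next_exists _ v w; first by move=> e'; rewrite e' distxx in e.
have Evu : E v u by rewrite adjacent_sym.
have uv2 : u <> v2.
  by move=> e'; subst v2; move: hw dv; rewrite /halftree /=; clear; lia.
apply: (IH v v2) => //; last by move: dv; rewrite e => -[].
apply: contrapT => gv2; apply: nbv.
apply: (branching_of3 Evu Ev (c := g v2)) => //.
- by rewrite -gv autg.
- by rewrite -{1}gu => /perm_inj.
- exact: nesym.
Qed.

(* [t] moves the complement of one halftree at [x] strictly inside another one,
   so that the translates of a third halftree at [x] are pairwise disjoint. *)
Definition ping_pong (t : permutation V) x v y n1 :=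
  [/\ E x v, E x y, E x n1, [/\ v <> y, v <> n1 & y <> n1]
    & forall z, halftree v x z -> halftree x n1 (t z)].

(** Let [n1] and [n2] be the directions at [x] towards its image and its preimage by [g]. For [v]
    other than these, [g] maps the halftree of [v] into that of [n1]. The element [w] is such that
    [w * g * w^-1] maps the complement of the halftree of [v] into it, and [g] is applied
    afterwards. *)
Lemma ping_pong_exists g : G g -> g <> 1%g ->
  exists2 u, G u & exists x v y n1, ping_pong (g * g ^ u)%g x v y n1.
Proof.
move=> Gg g1; have autg := plus_aut Gg.
have Gg' : G g^-1%g by exact: (subgroupV sG).
(* Every vertex lies between two branching ones, so an element fixing all of these is trivial. *)
have [x bx gx] : exists2 x, branching x & g x <> x.
  apply: contrapT => none; apply: g1; apply: permutation_eq => z; rewrite perm1.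
  have fixb w : branching w -> g w = w.
    by move=> bw; apply: contrapT => gw; apply: none; exists w.
  have [y [y' [Ey Ey' yy']]] := two_neighbors_ex z; have [p bp] := branching_ex.
  have [h Gh hw] := orbit_meets p Ey; have [h' Gh' hw'] := orbit_meets p Ey'.
  have b1 := halftree_two Ey Ey' yy' hw hw'.
  have e1 := fixb _ (plus_branching Gh bp); have e2 := fixb _ (plus_branching Gh' bp).
  move: b1 e1 e2; move: (h p) (h' p) => w w' b1 e1 e2.
  have b2 : between w (g z) w' by rewrite -{1}e1 -{1}e2 between_aut // /between b1
    (distC w).
  apply: (between_unique b2); first by rewrite /between b1.
  by rewrite -{1}e1 dist_aut.
have [n1 [En1 dn1]] := next_exists (nesym gx).
have [|n2 [En2 dn2]] := @next_exists _ x ((g^-1)%g x).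
  by move=> e; apply: gx; rewrite {1}e permKV.
have [v [Ev vn1 vn2]] := branching_avoid n1 n2 bx.
have [y [Ey yv yn1]] := branching_avoid v n1 bx.
have [w Gw push] := push_halftree bx Ev Ev.
exists w^-1%g; first exact: (subgroupV sG).
exists x, v, y, n1; split=> //; first by split=> //; exact: nesym.
have Evx : E v x by rewrite adjacent_sym.
have star z : halftree x v z -> halftree x n1 (g z).
  move=> hz; have E1 : E (g x) (g n2) by rewrite autg.
  have E2 : E (g x) (g v) by rewrite autg.
  have ne : g n2 <> g v by move=> /perm_inj /esym.
  have dd : dist x (g x) = (dist x (g n2)).+1.
    rewrite distC -{2}(permKV g x) dist_aut // dn2 -(dist_aut autg n2) permKV.
    by rewrite (distC (g n2)).
  have h2 : halftree (g x) (g v) (g z) by rewrite halftree_aut.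
  by have [] := geodesic_extend En1 E1 E2 ne dn1 dd h2.
have autw := plus_aut Gw.
move=> z hz; rewrite conjgE invgK !permM.
have hz1 : halftree x v ((w^-1)%g z).
  apply: contrapT => /(halftreeC Ev) h; apply: (halftree_disj hz); apply: push.
  by rewrite -(permKV w z) halftree_aut.
apply/star/push; rewrite halftree_aut //; apply: halftreeC => // h.
by apply: vn1; apply: next_unique h (star _ hz1).
Qed.


(** * Elements supported on a wandering halftree *)

Section Commutator.
Variables (t : permutation V) (x v y n1 : V).
Hypotheses (Gt : G t) (pp : ping_pong t x v y n1).
Local Notation Y := (halftree x y).

Lemma ping_pong_opp z : Y z -> halftree v x z.
Proof.
have [Ev Ey _ [vy _ _] _] := pp => hz.
by apply: (halftreeC Ev) => h; apply: vy; exact: (next_unique Ev Ey h hz).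
Qed.

Lemma ping_pong_iter i z : halftree v x z -> halftree x n1 ((t ^+ i.+1)%g z).
Proof.
have [Ev _ En [_ vn _] tD] := pp; elim: i z => [|i IH] z hz.
  by rewrite expg1; apply: tD.
rewrite expgS permM; apply: tD; apply: (halftreeC Ev) => h; apply: vn;
  exact: (next_unique Ev En h (IH _ hz)).
Qed.

Lemma wandering i z : halftree v x z -> ~ Y ((t ^+ i.+1)%g z).
Proof.
have [_ Ey En [_ _ yn] _] := pp => hz h.
by apply: yn; exact: (next_unique Ey En h (ping_pong_iter i hz)).
Qed.

Lemma wandering_root i z : halftree v x z -> (t ^+ i.+1)%g z <> x.
Proof.
by move=> hz e; have := ping_pong_iter i hz; rewrite e; apply: halftree_opp.
Qed.

Lemma wandering_base i z : Y z -> (t ^+ i)%g z <> v.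
Proof.
have [Ev Ey En [vy vn yn] tD] := pp => hz.
have hv : halftree x v v by apply: halftree_self.
case: i => [|i] e.
  by apply: vy; apply: (next_unique Ev Ey hv); rewrite -[v]e.
apply: vn; apply: (next_unique Ev En hv); rewrite -[v]e.
exact: (ping_pong_iter i (ping_pong_opp hz)).
Qed.

Definition in_translates z := exists2 ia : nat * V, Y ia.2 & (t ^+ ia.1)%g ia.2 = z.

Lemma translate_unique i j a c : Y a -> Y c -> (t ^+ i)%g a = (t ^+ j)%g c ->
  i = j /\ a = c.
Proof.
wlog ij : i j a c / i <= j => [wl|] Ya Yc e.
  by case: (leqP i j) => [/wl|/ltnW /wl H]; [apply|have [-> ->] :=
    H _ _ Yc Ya (esym e)].
move: e; rewrite -(subnKC ij) expgnDr permM => /perm_inj.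
case: (j - i) => [|n] e; first by rewrite addn0.
by case: (wandering (i := n) (ping_pong_opp Yc)); rewrite -e.
Qed.

Lemma not_translateS z : ~ in_translates z -> in_translates (t z) -> Y (t z).
Proof.
move=> nz [[[|i] a] /= Ya e]; first by rewrite -e.
case: nz; exists (i, a) => //=; apply: (@perm_inj _ t).
by rewrite -e expgS permM.
Qed.

(** The infinite product of the [t ^+ i * r * t ^- i], for [r] supported on [Y]. By
    [translate_unique] the supports are disjoint, so the chosen pair is the only one. *)
Definition wandering_product (r : permutation V) z :=
  if pselect (in_translates z) is left h then
    let ia := sval (cid2 h) in (t ^+ ia.1)%g (r ia.2)
  else z.

Lemma wandering_productE r i a : Y a ->
  wandering_product r ((t ^+ i)%g a) = (t ^+ i)%g (r a).
Proof.
move=> Ya; rewrite /wandering_product; case: pselect => [h|[]]; last by exists (i, a).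
by case: cid2 => -[j c] /= Yc e; have [-> ->] := translate_unique Yc Ya e.
Qed.

Lemma wandering_product0 r z : ~ in_translates z -> wandering_product r z = z.
Proof. by rewrite /wandering_product; case: pselect. Qed.

Lemma support_inv (s : permutation V) : (forall z, ~ Y z -> s z = z) ->
  forall z, ~ Y z -> (s^-1)%g z = z.
Proof. by move=> supp z /supp {1}<-; rewrite permK. Qed.

Lemma support_stable (s : permutation V) z : (forall z, ~ Y z -> s z = z) ->
  Y z -> Y (s z).
Proof.
move=> supp hz; apply: contrapT => h; apply: (h).
by have /perm_inj -> := supp _ h.
Qed.

Lemma wandering_productK (s : permutation V) : (forall z, ~ Y z -> s z = z) ->
  cancel (wandering_product s) (wandering_product s^-1%g).
Proof.
move=> supp z; have [[[i a] /= Ya <-]|nz] := pselect (in_translates z).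
  by rewrite wandering_productE // wandering_productE ?permK //; apply: support_stable.
by rewrite !wandering_product0.
Qed.

Lemma wandering_product_local (s : permutation V) :
  A s -> (forall z, ~ Y z -> s z = z) -> locally_colored (wandering_product s).
Proof.
have [Ev Ey En [vy vn yn] tD] := pp; move=> As supp.
(* An edge leaving the translate of [Y] by [t ^+ i] ends at [(t ^+ i) x]. This vertex is in no
   translate, so the product fixes it and agrees there with the factor of index [i]. *)
have rootx i : ~ in_translates ((t ^+ i)%g x).
  have hx : halftree v x x by apply: halftree_self; rewrite adjacent_sym.
  move=> [[j a] /= Ya e]; have [le|/ltnW le] := leqP i j.
    move: e; rewrite -(subnKC le) expgnDr permM => /perm_inj.
    case: (j - i) => [|n] e; first by move: Ya; rewrite -[a]/((t ^+ 0)%g a) e;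
      apply: halftree_opp.
    exact: (wandering_root (ping_pong_opp Ya) e).
  move: e; rewrite -(subnKC le) expgnDr permM => /perm_inj.
  case: (i - j) => [|n] e; first by move: Ya; rewrite e; apply: halftree_opp.
  by apply: (wandering (i := n) hx); rewrite -e.
have At i : A (t ^+ i)%g by exact: (subgroupX i sA (plus_incl Gt)).
have loc i a z' : Y a -> (t ^+ i)%g a = z' \/ E ((t ^+ i)%g a) z' ->
    exists2 g, A g & wandering_product s ((t ^+ i)%g a) = g ((t ^+ i)%g a)
                  /\ wandering_product s z' = g z'.
  move=> Ya zz'; exists (t ^+ i * s * (t ^+ i)^-1)%g.
    exact: (subgroupM sA (subgroupM sA (At i) As) (subgroupV sA (At i))).
  rewrite wandering_productE // !permM permK; split=> //.
  rewrite -(permKV (t ^+ i)%g z') in zz' *; move: ((t ^+ i)^-1%g z') zz' => c zz'.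
  rewrite permK; have [Yc|nYc] := pselect (Y c); first by rewrite wandering_productE.
  rewrite supp //; case: zz' => [/perm_inj e|]; first by rewrite -e in nYc.
  rewrite (At i).1 => Eac; have [_ ->] := halftree_edge Ey Eac Ya (halftreeC Ey nYc).
  by rewrite wandering_product0.
move=> z z' zz'.
have zz'C : z' = z \/ E z' z by case: zz' => [->|]; [left|rewrite adjacent_sym; right].
have [[[i a] /= Ya e]|nz] := pselect (in_translates z).
  by rewrite -e in zz' *; apply: loc.
have [[[i a] /= Ya e]|nz'] := pselect (in_translates z').
  by rewrite -e in zz'C *; have [g Ag [h1 h2]] := loc _ _ _ Ya zz'C; exists g.
by exists 1%g; [exact: (subgroup1 sA)|rewrite !wandering_product0].
Qed.

(* [s] is the commutator of [t] with the product of all the [t ^+ i * s * t ^- i]. *)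
Lemma supported_commutator (s : permutation V) : A s ->
  (forall z, ~ Y z -> s z = z) -> exists2 r, G r & s = (r * t * r^-1 * t^-1)%g.
Proof.
have [Ev Ey En [vy vn yn] tD] := pp; move=> As supp.
have As' : A s^-1%g by exact: (subgroupV sA).
have supp' := support_inv supp.
have K := wandering_productK supp; have K' := wandering_productK supp'.
rewrite invgK in K'.
have [||r Ar rE] := glue K K'; try exact: wandering_product_local.
exists r.
  (* The product fixes both [x] and [v], which puts it in [G] and not merely in [A]. *)
  apply: (fix_edge_plus Ar Ev); rewrite rE wandering_product0 //.
    move=> [[[|i] a] /= Ya e].
      by move: Ya; rewrite -[a]/((t ^+ 0)%g a) e; apply: halftree_opp.
    exact: (wandering_root (ping_pong_opp Ya) e).
  by move=> [[i a] /= Ya e]; exact: (wandering_base Ya e).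
(* Conjugation by [t] shifts the factors, so [t * r * t^-1] lacks only the factor [s] of index 0. *)
suff e : (s * t * r = r * t)%g by rewrite -e mulgK mulgK.
apply: permutation_eq => z; rewrite !permM !rE.
have [[[i a] /= Ya <-]|nz] := pselect (in_translates z).
  have tS c : t ((t ^+ i)%g c) = (t ^+ i.+1)%g c by rewrite expgS.
  rewrite wandering_productE // !tS wandering_productE //.
  exact/supp/wandering/ping_pong_opp/(support_stable supp).
rewrite [in LHS]wandering_product0 //.
have [tz|ntz] := pselect (in_translates (t z)).
  have Yt := not_translateS nz tz.
  exact: (esym (wandering_productE s 0 Yt)).
rewrite wandering_product0 //; apply: supp => Yt; apply: ntz.
by exists (0, t z).
Qed.

End Commutator.

(** * Products of conjugates *)

Section ConjugateProducts.
Variable g : permutation V.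
Hypothesis Gg : G g.

Definition conjugate_product n h := exists s : seq (permutation V),
  [/\ size s <= n,
      forall r, r \in s -> exists2 u, G u & r = (g ^ u)%g \/ r = (g^-1 ^ u)%g
    & h = (\prod_(r <- s) r)%g].

Lemma conjugate_product1 u : G u -> conjugate_product 1 (g ^ u)%g.
Proof.
move=> Gu; exists [:: (g ^ u)%g]; split=> //; last by rewrite big_seq1.
by move=> r; rewrite inE => /eqP ->; exists u => //; left.
Qed.

Lemma conjugate_productV u : G u -> conjugate_product 1 (g^-1 ^ u)%g.
Proof.
move=> Gu; exists [:: (g^-1 ^ u)%g]; split=> //; last by rewrite big_seq1.
by move=> r; rewrite inE => /eqP ->; exists u => //; right.
Qed.

Lemma conjugate_productM m n a c :
  conjugate_product m a -> conjugate_product n c ->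
  conjugate_product (m + n) (a * c)%g.
Proof.
move=> [r [szr rC ->]] [s [szs sC ->]]; exists (r ++ s); split.
- by rewrite size_cat leq_add.
- by move=> q; rewrite mem_cat => /orP[/rC|/sC].
- by rewrite big_cat.
Qed.

Lemma conjugate_productJ n a u : G u ->
  conjugate_product n a -> conjugate_product n (a ^ u)%g.
Proof.
move=> Gu [s [szs sC ->]]; exists [seq (r ^ u)%g | r <- s]; split.
- by rewrite size_map.
- move=> _ /mapP[r /sC[q Gq rq] ->]; exists (q * u)%g; first exact: (subgroupM sG).
  by rewrite !conjgM; case: rq => ->; [left|right].
- by rewrite big_map conjg_prod.
Qed.

(** A conjugate of [s] is supported on the wandering halftree of [t = g * g ^ u], hence is a
    commutator with [t]. Conjugates of [t] and of its inverse cost two factors each. *)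
Lemma conjugate_product_fix s p e : g <> 1%g -> A s -> branching p -> E p e ->
  (forall z, halftree p e z -> s z = z) -> conjugate_product 4 s.
Proof.
move=> g1 As bp Epe sfix.
have [u Gu [x [v [y [n1 pp]]]]] := ping_pong_exists Gg g1.
set t := (g * g ^ u)%g in pp.
have Gt : G t by exact: (subgroupM sG Gg (subgroupJ sG Gg Gu)).
have G1 := subgroup1 sG.
have ct : conjugate_product 2 t.
  rewrite /t -{1}[g]conjg1 -[2]/(1 + 1).
  by apply: conjugate_productM; apply: conjugate_product1.
have ct' : conjugate_product 2 t^-1%g.
  rewrite /t invgM -conjVg -{2}[g^-1%g]conjg1 -[2]/(1 + 1).
  by apply: conjugate_productM; apply: conjugate_productV.
have Ey : E x y by case: pp.
have [w Gw push] := push_halftree bp Epe Ey.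
have autw := plus_aut Gw; have Gw' : G w^-1%g by exact: (subgroupV sG).
have Aw := plus_incl Gw.
have [|z nz|r Gr e1] := @supported_commutator _ _ _ _ _ Gt pp (s ^ w^-1)%g.
- exact: (subgroupJ sA As (subgroupV sA Aw)).
- rewrite conjgE invgK !permM sfix ?permKV //; apply: contrapT => h.
  apply: nz; apply: push; rewrite -(permKV w z) halftree_aut //.
  by apply: halftreeC h.
have -> : s = ((t ^ r^-1 * t^-1) ^ w)%g.
  rewrite -[LHS](conjgKV w) e1; congr (_ ^ _)%g.
  by rewrite conjgE invgK !mulgA.
apply: conjugate_productJ => //; rewrite -[4]/(2 + 2).
apply: conjugate_productM ct'; apply: conjugate_productJ ct.
exact: (subgroupV sG).
Qed.

End ConjugateProducts.

(** * Decomposition into two elements fixing halftrees *)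

Definition fixes_halftree s := exists p e,
  [/\ branching p, E p e & forall z, halftree p e z -> s z = z].

(** [p] is the midpoint of [w] and [h w], and it branches because [2 * k] divides their distance.
    The direction [e] at [p] avoids both, and [w'] is a neighbor of [w] such that [w'] and [h w']
    both lead away from [p]. *)
Lemma symmetric_position h : G h -> exists p e w w',
  [/\ branching p, branching w, E p e, E w w' &
   [/\ halftree e p w, halftree e p w', halftree e p (h w') &
   dist p w' = (dist p w).+1 /\ dist p (h w) = dist p w /\ dist p (h w') = (dist p
     w).+1]].
Proof.
move=> Gh; have auth := plus_aut Gh.
have [w bw] := branching_ex; have [n [dw kn]] :
  exists n, dist w (h w) = 2 * n /\ k %| n.
  have := even_plus Gh bw => dv; exists (dist w (h w) %/ 2).
  have d2 : 2 %| dist w (h w) by apply: dvdn_trans dv; apply: dvdn_mulr.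
  by rewrite mulnC divnK // -(@dvdn_pmul2l 2) // mulnC [2 * _]mulnC divnK // mulnC.
have [|p bt pn] := @between_exists _ w (h w) n; first by rewrite dw leq_pmull.
have bp : branching p by apply/(spacing _ bw); rewrite pn.
have pw : dist p w = n by rewrite distC.
have phw : dist p (h w) = n by move: bt; rewrite /between dw pn; lia.
have [n0|n0] := posnP n.
  have ewp : p = w by apply: dist_eq0; rewrite pw.
  have hp : h w = w by rewrite -ewp; apply/esym/dist_eq0; rewrite {2}ewp phw.
  have [_ [w' [_ Ew _]]] := two_neighbors_ex w.
  have [e [Ee ew' ehw']] := branching_avoid w' (h w') bw.
  have Ehw : E w (h w') by rewrite -{1}hp auth.
  exists w, e, w, w'; split=> //; split.
  - by apply: halftree_self; rewrite adjacent_sym.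
  - exact: halftree_neighbor.
  - exact: halftree_neighbor.
  - by rewrite hp distxx !dist_adjacent.
have neq0 (a c : V) : dist a c = n -> a <> c by move=> dac e;
  rewrite e distxx in dac; lia.
have [a1 [E1 d1]] := next_exists (neq0 _ _ pw).
have [a2 [E2 d2]] := next_exists (neq0 _ _ phw).
have [e [Ee ea1 ea2]] := branching_avoid a1 a2 bp.
have wp : dist w p = n by rewrite distC.
have whp : dist w ((h^-1)%g p) = n by rewrite -(dist_aut auth) permKV distC.
have [b1 [F1 f1]] := next_exists (neq0 _ _ wp).
have [b2 [F2 f2]] := next_exists (neq0 _ _ whp).
have [w' [Ew wb1 wb2]] := branching_avoid b1 b2 bw.
have dw' : dist p w' = n.+1.
  have [dd|] := adjacent_dist p Ew; first by case: wb1;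
    exact: (next_unique Ew F1 dd f1).
  by rewrite wp distC.
have dhw' : dist p (h w') = n.+1.
  rewrite -{1}(permKV h p) (dist_aut auth) distC.
  have [dd|] := adjacent_dist ((h^-1)%g p) Ew; last by rewrite whp.
  by case: wb2; exact: (next_unique Ew F2 dd f2).
have side a u u' : E p a -> halftree p a u -> e <> a -> dist p u = n -> E u u' ->
    dist p u' = n.+1 -> halftree e p u /\ halftree e p u'.
  move=> Ea hu ea pu Euu pu'; have hu' : halftree p a u'.
    move: hu (dist_triangle a u u') (adjacent_dist u' Ea);
      rewrite /halftree /= pu' pu (dist_adjacent Euu).
    by clear; lia.
  by split; apply: (halftreeC Ee) => hh; apply: ea; [exact: (next_unique Ee Ea hh hu)|
    exact: (next_unique Ee Ea hh hu')].
have [h1 h2] := side _ _ _ E1 d1 ea1 pw Ew dw'.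
have Ehw : E (h w) (h w') by rewrite auth.
have [_ h4] := side _ _ _ E2 d2 ea2 phw Ehw dhw'.
by exists p, e, w, w'; split=> //; split=> //; rewrite pw.
Qed.

(** By [extend_halftree] some [b0] fixes the halftree of [e] at [p] and agrees with [h] on the edge
    from [w] to [w']. Let [c] be [h] beyond this edge and [b0] before it: [c] fixes the halftree of
    [e], and [h * c^-1] fixes the image by [h] of the halftree of [w']. *)
Lemma plus_decomposition h : G h -> exists a c,
  [/\ A a, A c, fixes_halftree a, fixes_halftree c & h = (a * c)%g].
Proof.
move=> Gh; have auth := plus_aut Gh; have Ah := plus_incl Gh.
have [p [e [w [w' [bp bw Ee Ew [hw hw' hhw' [dw' [dhw dhw']]]]]]]] :=
  symmetric_position Gh.
have Eep : E e p by rewrite adjacent_sym.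
have [b0 Ab [bp0 bw' bfix]] := extend_halftree Ee hw' hhw' dw' dhw'.
have autb : automorphisms E b0 by case: Ab.
have b0w : b0 w = h w.
  apply: (@between_unique _ p _ _ (h w')); rewrite /between.
  - by rewrite -bw' -{1 2}bp0 !dist_aut // dw' (dist_adjacent Ew) addn1.
  - by rewrite dhw' dhw (dist_aut auth) (dist_adjacent Ew) addn1.
  - by rewrite dhw -{1}bp0 dist_aut.
have [c Ac [cin cout]] := glue_halftree Ah Ab Ew (esym b0w) (esym bw').
exists (h * c^-1)%g, c; split=> //; last by rewrite mulgVK.
- exact: (subgroupM sA Ah (subgroupV sA Ac)).
- exists (h w), (h w'); split; [exact: plus_branching|by rewrite auth|].
  move=> z hz; have hz' : halftree w w' ((h^-1)%g z).
    by rewrite -(halftree_aut auth) permKV.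
  have e1 : c ((h^-1)%g z) = z by rewrite cin // permKV.
  by rewrite permM -{1}e1 permK permKV.
exists p, e; split=> // z hz; rewrite cout ?bfix // => hz'.
have := halftree_cross Ee hz hw'; have := halftree_cross Ee hz hw.
by move: hz'; rewrite /halftree /= (distC w) (distC w') dw'; clear; lia.
Qed.

Lemma plus_8_boundedly_simple : n_boundedly_simple 8 G.
Proof.
move=> g h Gg g1 Gh _;
  have [a [c [Aa Ac [p [e [bp Ee af]]] [q [e' [bq Ee' cf]]] ->]]] :=
  plus_decomposition Gh.
rewrite -[8]/(4 + 4); apply: conjugate_productM.
  exact: conjugate_product_fix af.
exact: conjugate_product_fix cf.
Qed.

End ColoredTree.

(** * Convex sets as subtrees, and the conclusion *)

Section Subtrees.
Variable T : tree.
Local Notation V := (vertex T).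
Local Notation E := (@adjacent T).

Lemma convex_is_subtree (S : set V) : convex S -> is_subtree E S.
Proof.
move=> cS; split.
- by move=> x y; rewrite /induced adjacent_sym.
- by move=> x; rewrite /induced adjacent_irr.
- move=> x y.
  pose P z := exists2 p, path (@induced V E S) x p & val (last x p) = z.
  have Px : P (val x) by exists [::].
  suff step u v : S u -> S v -> E u v -> P u -> P v.
    have [p pp lp] := convex_ind cS (set_mem (valP x)) Px step (set_mem (valP y)).
    by exists p => //; apply: val_inj.
  move=> Su Sv Euv [p pp lp]; exists (rcons p (exist _ v (mem_set Sv))).
    by rewrite rcons_path pp /= /induced /= lp.
  by rewrite last_rcons.
- move=> p up cp; rewrite -(size_map (val : S -> V)); apply: adjacent_acyclic.
    have vi : injective (val : S -> V) by exact: val_inj.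
    by rewrite (@map_inj_uniq {classic S} V val vi).
  by case: p up cp => //= x p _; rewrite -map_rcons path_map.
Qed.

Lemma invariant_leaves (G : set (permutation V)) (S : set V) : subgroup_set G ->
  (forall g x, G g -> S x -> S (g x)) -> leaves_invariant G S.
Proof.
move=> sG iS g Gg; apply/seteqP; split=> [_ [x Sx <-]|x Sx]; first exact: iS.
exists ((g^-1)%g x); last exact: permKV.
by apply: iS => //; exact: (subgroupV sG).
Qed.

Section Main.
Variables (I : Type) (f : V -> I).
Local Notation G := (color_automorphisms_plus E f).
Hypothesis bsimple : boundedly_simple G.

Let autG := @plus_aut T I f.
Let sG : subgroup_set G := generated_is_subgroup _.

Lemma edge_stabilizers_fix g :
  (exists x y, E x y /\ edge_stabilizer E f x y g) -> exists x, g x = x.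
Proof. by move=> [x [y [_ [_ gx _]]]]; exists x. Qed.

Lemma minimal_is_uniform (S : set V) (W : Type) (EW : rel W) (iota : W -> V) :
  convex S -> (S !=set0)%classic -> (forall g x, G g -> S x -> S (g x)) ->
  (forall S' : set V, convex S' -> (S' !=set0)%classic -> (S' `<=` S)%classic ->
    (forall g x, G g -> S' x -> S' (g x)) -> (S `<=` S')%classic) ->
  (forall x, S x -> ~ fixes_vertex G x) ->
  injective iota -> (forall x y, EW x y = E (iota x) (iota y)) ->
  (forall z, S z <-> exists w, iota w = z) -> is_tree EW ->
  is_uniform_subdivision_of_biregular EW.
Proof.
move=> cS S0 iS mS nofix.
have [k [k0 [p1 [q1 [Sp1 Sq1 bp1 dk]]] sp]] :=
  branching_spacing autG edge_stabilizers_fix cS iS mS nofix bsimple S0.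
exact: (uniform_of_spacing autG edge_stabilizers_fix cS iS mS bsimple k0 Sp1 Sq1
  bp1 dk sp).
Qed.

Lemma minimal_8_boundedly_simple (x0 : V) :
  (forall S' : set V, convex S' -> (S' !=set0)%classic ->
    (forall g x, G g -> S' x -> S' (g x)) -> S' = [set: V]%classic) ->
  (forall x, ~ fixes_vertex G x) -> n_boundedly_simple 8 G.
Proof.
move=> min nofix.
have cT : convex [set: V]%classic by [].
have iT g x : G g -> [set: V]%classic x -> [set: V]%classic (g x) by [].
have mT (S' : set V) : convex S' -> (S' !=set0)%classic -> (S' `<=` setT)%classic ->
    (forall g x, G g -> S' x -> S' (g x)) -> ([set: V] `<=` S')%classic.
  by move=> c0 n0 _ i0; rewrite (min S').
have nT x : [set: V]%classic x -> ~ (forall g, G g -> g x = x) by move=> _;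
  apply: nofix.
have T0 : ([set: V] !=set0)%classic by exists x0.
have [k [k0 [p1 [q1 [Sp1 Sq1 bp1 dk]]] sp]] :=
  branching_spacing autG edge_stabilizers_fix cT iT mT nT bsimple T0.
apply: (@plus_8_boundedly_simple T I f _ _ k) => //.
- by move=> p q w Eq; apply: (orbit_half autG cT iT mT).
- by move=> b y y' bb Ey Ey';
    apply: (local_transitivity autG edge_stabilizers_fix cT iT mT bsimple).
- by move=> p x bp; apply: sp.
- by exists p1.
- move=> x; have [y _ Ey] := neighbor_ex cT iT nT (Logic.I : [set: V]%classic x).
  have [//|//|//|z [_ Ez yz]] :=
    @two_neighbors _ _ autG edge_stabilizers_fix _ cT iT mT x y.
  by exists y, z.
Qed.

End Main.
End Subtrees.

Theorem theorem3p11 (V : Type) (E : rel V) (I : Type) (f : V -> I)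
    (treeE : is_tree E)
    (bsimple : boundedly_simple (color_automorphisms_plus E f))
    (nontriv : nontrivial_subgroup (color_automorphisms_plus E f)) :
  ((exists x : V, fixes_vertex (color_automorphisms_plus E f) x) \/
   (exists b : set (nat -> V),
      is_end E b /\ fixes_end (color_automorphisms_plus E f) b) \/
   (exists S : set V,
      [/\ is_subtree E S,
          leaves_invariant (color_automorphisms_plus E f) S
        & is_uniform_subdivision_of_biregular (@induced V E S)])) /\
  ((forall S : set V, is_subtree E S -> (S !=set0)%classic ->
      leaves_invariant (color_automorphisms_plus E f) S -> S = [set: V]%classic) ->
   (forall b : set (nat -> V),
      is_end E b -> ~ fixes_end (color_automorphisms_plus E f) b) ->
   is_uniform_subdivision_of_biregular E /\
   n_boundedly_simple 8 (color_automorphisms_plus E f)).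
Proof.
have [symE irrE connE acyE] := treeE.
pose T := @Tree {classic V} E symE irrE connE acyE.
have autG := @plus_aut T I f.
have sG : subgroup_set (color_automorphisms_plus E f) := generated_is_subgroup _.
have [g0 Gg0 g01] := nontriv.
(* [is_tree] allows the empty graph, but a nontrivial permutation needs a vertex. *)
have [x0 _] : exists x0 : T, True.
  apply: contrapT => none; apply: g01; apply: permutation_eq => x.
  by case: none; exists x.
split.
  have [fixV|nofix] := pselect (exists x :
    V, fixes_vertex (color_automorphisms_plus E f) x).
    by left.
  right; have [fixb|noend] := pselect (exists b, is_end E b /\
    fixes_end (color_automorphisms_plus E f) b); first by left.
  right; have [S [cS S0 iS] mS] :=
    @minimal_invariant_convex T _ sG autG x0 noend.
  have treeS : is_subtree E S := convex_is_subtree cS.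
  exists S; split=> //; first exact: (@invariant_leaves T _ S sG iS).
  apply: (@minimal_is_uniform T I f bsimple S _ _ (fun w :
    @set_type V S => val w) cS S0 iS) => //.
  - by move=> S' c0 n0 S'S i0; apply: mS.
  - by move=> x _ fx; apply: nofix; exists x.
  - move=> z; split=> [Sz|[w <-]]; first by exists (exist _ z (mem_set Sz)).
    exact: set_mem (valP w).
move=> minV _.
have min (S' : set T) : convex S' -> (S' !=set0)%classic ->
    (forall g x, color_automorphisms_plus E f g -> S' x -> S' (g x)) ->
    S' = [set: T]%classic.
  move=> cS' S'0 iS'; apply: minV => //; first exact: (convex_is_subtree cS').
  exact: (@invariant_leaves T _ S' sG iS').
(* A fixed vertex would form an invariant subtree, hence be the whole tree, and the group would be
   trivial. *)
have nofix x : ~ fixes_vertex (color_automorphisms_plus E f) x.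
  move=> fx; have e : [set x]%classic = [set: T]%classic.
    apply: min => [a m c -> -> b||g _ Gg ->]; [|by exists x|exact: fx].
    apply: esym; apply: (@dist_eq0 T); move: b; rewrite /between distxx; lia.
  apply: g01; apply: permutation_eq => y.
  have -> : y = x by have : [set x]%classic y by rewrite e.
  exact: fx.
split; last exact: (@minimal_8_boundedly_simple T I f bsimple x0 min nofix).
apply: (@minimal_is_uniform T I f bsimple [set: T]%classic _ _ id) => //.
- by exists x0.
- by move=> S' c0 n0 _ i0; rewrite (min S').
- by move=> z; split=> // _; exists z.
Qed.
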